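(* Assume that every $\mathbf{\Sigma}^1_2$ set is either Baire measurable or $K_\sigma$-regular. Then refining forcing collapses the continuum to $\mathfrak{d}$; that is, it forces that there is a surjection from $\mathfrak{d}^V$ onto the set of ground model reals.
   Context: For $x,y\in[\omega]^\omega$, $y$ refines $x$ if $y\subseteq^*x$ or $y\subseteq^*\omega\setminus x$ (inclusion modulo finite sets). A family $B\subseteq[\omega]^\omega$ is $\omega$-refining if for every countable $C\subseteq[\omega]^\omega$ there is $y\in B$ that refines every $x\in C$. Refining forcing is the set of Borel $\omega$-refining families $B\subseteq[\omega]^\omega$, ordered by inclusion. A subset of $[\omega]^\omega$ is $K_\sigma$-regular if it is either contained in a $\sigma$-compact subset of $[\omega]^\omega$ or contains a superperfect set. Here $[\omega]^\omega$ is identified via increasing enumeration with the closed set of strictly increasing functions in $\omega^\omega$, and a superperfect set is the set of branches of a nonempty tree in which every node extends to a node with infinitely many immediate successors. A set is Baire measurable if it has the property of Baire. $\mathfrak{d}$ is the dominating number: the least size of a family $D\subseteq\omega^\omega$ such that every $f\in\omega^\omega$ is eventually dominated by some $g\in D$. *)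

(* Defs.v *)
From mathcomp Require Import all_boot all_order all_algebra.
From mathcomp Require Import all_classical all_reals all_analysis.

Set Implicit Arguments.
Unset Strict Implicit.
Unset Printing Implicit Defensive.

Local Open Scope classical_set_scope.

(** * Descriptive set theory *)

Notation baire := {ptws nat -> nat}.

(* An infinite subset of omega is represented by its increasing enumeration;
   [infset] carries the topology inherited from the Baire space, of which it is
   a closed subspace. *)
Definition increasing_functions : set baire :=
  [set f | {homo f : m n / (m < n)%N}].

Notation infset := (set_type increasing_functions).

Definition elements (x : infset) : set nat := range (set_val x : nat -> nat).

Definition Borel (X : topologicalType) (A : set X) : Prop :=
  <<s [set U : set X | open U] >> A.

(* Meant for Polish X, as are the next two notions *)
Definition Sigma11 (X : topologicalType) (A : set X) : Prop :=
  exists F : set (X * baire), closed F /\ A = [set x | exists y, F (x, y)].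

Definition Pi11 (X : topologicalType) (A : set X) : Prop := Sigma11 (~` A).

Definition Sigma12 (X : topologicalType) (A : set X) : Prop :=
  exists B : set (X * baire), Pi11 B /\ A = [set x | exists y, B (x, y)].

Definition nowhere_dense (X : topologicalType) (A : set X) : Prop :=
  interior (closure A) = set0.

Definition meager (X : topologicalType) (A : set X) : Prop :=
  exists F : nat -> set X,
    (forall n, nowhere_dense (F n)) /\ A `<=` \bigcup_n F n.

Definition Baire_measurable (X : topologicalType) (A : set X) : Prop :=
  exists U : set X, open U /\ meager (A `+` U).

Definition sigma_compact (X : topologicalType) (A : set X) : Prop :=
  exists K : nat -> set X, (forall n, compact (K n)) /\ A = \bigcup_n K n.

Definition tree (T : set (seq nat)) : Prop :=
  forall s t, prefix s t -> T t -> T s.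

Definition branches (T : set (seq nat)) : set baire :=
  [set f | forall n, T (mkseq f n)].

Definition superperfect (S : set baire) : Prop :=
  exists T : set (seq nat),
    [/\ tree T, T !=set0,
        forall s, T s -> exists t,
          [/\ T t, prefix s t & infinite_set [set n | T (rcons t n)]]
      & S = branches T].

Definition K_sigma_regular (A : set infset) : Prop :=
  (exists K : set infset, sigma_compact K /\ A `<=` K) \/
  (exists S : set baire, superperfect S /\ S `<=` set_val @` A).

(** * Refining forcing *)

Definition refines (y x : infset) : Prop :=
  finite_set (elements y `\` elements x) \/
  finite_set (elements y `\` ~` elements x).

Definition omega_refining (B : set infset) : Prop :=
  forall C : set infset, countable C ->
    exists2 y, B y & forall x, C x -> refines y x.

Definition refining_forcing : Type :=
  {B : set infset | Borel B /\ omega_refining B}.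

Definition refining_le (B C : refining_forcing) : Prop :=
  proj1_sig B `<=` proj1_sig C.

(** * The ground model

   Sets are well-founded trees up to extensional equality [veq] (Aczel). *)

Inductive vset : Type := vsup (A : Type) (a : A -> vset).

Fixpoint veq (x y : vset) : Prop :=
  let: vsup A a := x in let: vsup B b := y in
  (forall i, exists j, veq (a i) (b j)) /\ (forall j, exists i, veq (a i) (b j)).

Definition vmem (x y : vset) : Prop :=
  let: vsup B b := y in exists j, veq x (b j).

Definition vsubset (x y : vset) : Prop := forall z, vmem z x -> vmem z y.

Definition vtransitive (x : vset) : Prop := forall y, vmem y x -> vsubset y x.

Definition vordinal (x : vset) : Prop :=
  vtransitive x /\ forall y, vmem y x -> vtransitive y.

Fixpoint vnat (n : nat) : vset :=
  if n is m.+1 then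
    let: vsup A a := vnat m in
    vsup (fun o : option A => if o is Some i then a i else vsup a)
  else vsup (fun e : Empty_set => match e with end).

Definition vreals : vset :=
  vsup (fun x : set nat => vsup (fun n : {n | x n} => vnat (proj1_sig n))).

(* Equality in the ground model being [veq], bijections are taken up to it. *)
Definition equipotent (T : Type) (D : set T) (k : vset) : Prop :=
  exists F : T -> vset,
    [/\ forall f, D f -> vmem (F f) k,
        forall f g, D f -> D g -> veq (F f) (F g) -> f = g
      & forall z, vmem z k -> exists2 f, D f & veq (F f) z].

Definition dominating (D : set (nat -> nat)) : Prop :=
  forall f : nat -> nat, exists2 g, D g & \forall n \near \oo, (f n <= g n)%N.

Definition size_of_dominating_family (k : vset) : Prop :=
  vordinal k /\ exists D, dominating D /\ equipotent D k.

Definition is_dominating_number (d : vset) : Prop :=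
  size_of_dominating_family d /\
  forall k, size_of_dominating_family k -> vsubset d k.

(** * Formulas of set theory (in higher-order abstract syntax) *)

Inductive formula (X : Type) : Type :=
| fmem (x y : X)
| feq (x y : X)
| fand (phi psi : formula X)
| fnot (phi : formula X)
| fex (phi : X -> formula X).

Section Formulas.
Context {X : Type}.
Implicit Types (phi psi : formula X) (x y z f a b : X).

Definition fall (phi : X -> formula X) := fnot (fex (fun x => fnot (phi x))).
Definition for_ phi psi := fnot (fand (fnot phi) (fnot psi)).
Definition fimp phi psi := fnot (fand phi (fnot psi)).
Definition fiff phi psi := fand (fimp phi psi) (fimp psi phi).
Definition fall_in a (phi : X -> formula X) :=
  fall (fun x => fimp (fmem x a) (phi x)).
Definition fex_in a (phi : X -> formula X) :=
  fex (fun x => fand (fmem x a) (phi x)).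

(* z = {x, y} *)
Definition is_upair z x y :=
  fall (fun w => fiff (fmem w z) (for_ (feq w x) (feq w y))).

(* z = (x, y) = {{x}, {x, y}} *)
Definition is_pair z x y :=
  fex (fun u => fex (fun v =>
    fand (is_upair u x x) (fand (is_upair v x y) (is_upair z u v)))).

Definition maps_to f x y := fex_in f (fun z => is_pair z x y).

Definition is_function f a b :=
  fand (fall_in f (fun z => fex_in a (fun x => fex_in b (fun y => is_pair z x y))))
       (fall_in a (fun x => fex_in b (fun y =>
          fand (maps_to f x y)
               (fall (fun y' => fimp (maps_to f x y') (feq y' y)))))).

Definition exists_surjection a b :=
  fex (fun f => fand (is_function f a b)
    (fall_in b (fun y => fex_in a (fun x => maps_to f x y)))).

End Formulas.

(** * The forcing relation

   [Name c a] is the P-name consisting of the pairs (a i, c i). The clauses are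
   those of Kunen's forcing relation defined in the ground model. *)

Inductive name (P : Type) : Type :=
  Name (A : Type) (c : A -> P) (a : A -> name P).

(* No largest condition is assumed, so every element is paired with every
   condition. *)
Fixpoint check (P : Type) (x : vset) : name P :=
  let: vsup A a := x in
  Name (fun ip : A * P => ip.2) (fun ip => check P (a ip.1)).

Section Forcing.
Context {P : Type} (le : P -> P -> Prop).

Definition dense_below (p : P) (D : P -> Prop) : Prop :=
  forall q, le q p -> exists2 r, le r q & D r.

Fixpoint forces_eq (x y : name P) (p : P) : Prop :=
  let: Name A c a := x in let: Name B d b := y in
  (forall i, dense_below p (fun q => le q (c i) ->
     exists j, le q (d j) /\ forces_eq (a i) (b j) q)) /\
  (forall j, dense_below p (fun q => le q (d j) ->
     exists i, le q (c i) /\ forces_eq (a i) (b j) q)).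

Definition forces_mem (x y : name P) (p : P) : Prop :=
  let: Name B d b := y in
  dense_below p (fun q => exists j, le q (d j) /\ forces_eq x (b j) q).

Fixpoint forces (p : P) (phi : formula (name P)) : Prop :=
  match phi with
  | fmem x y => forces_mem x y p
  | feq x y => forces_eq x y p
  | fand phi psi => forces p phi /\ forces p psi
  | fnot phi => forall q, le q p -> ~ forces q phi
  | fex phi => dense_below p (fun q => exists x, forces q (phi x))
  end.

Definition forced (phi : formula (name P)) : Prop := forall p, forces p phi.

End Forcing.

(* Main.v *)
Require Import Defs.
From mathcomp Require Import all_boot all_order all_algebra.
From mathcomp Require Import all_classical all_reals all_analysis.
From mathcomp Require Import zify.

Set Implicit Arguments.
Unset Strict Implicit.
Unset Printing Implicit Defensive.

(* For [B] in refining forcing, let [E] be the set of the infinite [x] for which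
   the members of [B] almost disjoint from [x] do not form an omega-refining
   family.  It is Sigma^1_2, closed under supersets, and any two of its elements
   have infinite intersection, as [B] itself is omega-refining.  If [E] is
   non-meager with the property of Baire, or contains a superperfect set, then it
   has two almost disjoint elements, which is absurd.  So [E] is meager or contained in a
   sigma-compact set, and either way there is [h] such that every [x] in [E]
   meets [[n, h n)] for almost all [n].  Let [g] from a dominating family
   dominate [h] and cut omega into intervals [[b_k, b_(k+1))] with
   [b_(k+1) >= g (b_k)].  For every infinite co-infinite set [z] of indices, the
   members of [B] almost contained in the union [W] of the intervals indexed by
   [z] are then omega-refining, as the complement of [W] is not in [E].  Letting
   [z] range over an almost disjoint family indexed by the reals gives, for each
   [g], pairwise incompatible conditions [P_(g, r)]; the name sending the index
   of [g] to the real [r] with [P_(g, r)] in the generic filter is forced to be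
   onto. *)

(** * The forcing relation *)

Lemma veq_refl (s : vset) : veq s s.
Proof. by elim: s => C c IH; split=> i; exists i. Qed.

Lemma veq_sym (s t : vset) : veq s t -> veq t s.
Proof.
elim: s t => C c IH [D d] [st ts]; split=> k.
  by have [i /IH] := ts k; exists i.
by have [i /IH] := st k; exists i.
Qed.

Lemma veq_trans (s t u : vset) : veq s t -> veq t u -> veq s u.
Proof.
elim: s t u => C c IH [D d] [F f] [st ts] [tu ut]; split=> k.
  by have [l /IH kl] := st k; have [m /kl] := tu l; exists m.
by have [l lk] := ut k; have [m ml] := ts l; exists m; exact: IH lk.
Qed.

Section ForcingTheory.
Context (P : Type) (le : P -> P -> Prop).
Hypothesis le_refl : forall p, le p p.
Hypothesis le_trans : forall p q r, le p q -> le q r -> le p r.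

Local Notation dense_below := (dense_below le).
Local Notation feq' := (forces_eq le).
Local Notation fmem' := (forces_mem le).
Local Notation forces := (forces le).
Implicit Types (p q r : P) (x y z u v w : name P).

Lemma dense_below_mono p q D : le q p -> dense_below p D -> dense_below q D.
Proof. by move=> qp Dp r rq; apply: Dp; exact: le_trans qp. Qed.

Lemma dense_below_dense p D : dense_below p (dense_below ^~ D) -> dense_below p D.
Proof.
move=> Dp q /Dp[r rq /(_ _ (le_refl r))[s sr Ds]].
by exists s => //; exact: le_trans rq.
Qed.

Lemma dense_below_impl p (D D' : P -> Prop) :
  (forall q, le q p -> D q -> D' q) -> dense_below p D -> dense_below p D'.
Proof.
move=> DD' Dp q qp; have [r rq Dr] := Dp _ qp.
by exists r => //; apply: DD' => //; exact: le_trans qp.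
Qed.

Lemma dense_below_all p (D : P -> Prop) :
  (forall q, le q p -> D q) -> dense_below p D.
Proof. by move=> Dp q qp; exists q => //; exact: Dp. Qed.

Lemma forces_eq_mono x y p q : le q p -> feq' x y p -> feq' x y q.
Proof.
case: x y => A c a [B d b] qp /= [xy yx].
by split=> k; apply: (dense_below_mono qp).
Qed.

(** Both clauses of [forces_eq] are themselves statements of density, and densely dense means
    dense. *)
Lemma forces_eq_dense x y p : dense_below p (feq' x y) -> feq' x y p.
Proof.
case: x y => A c a [B d b] Dp /=.
by split=> k; apply: dense_below_dense; apply: dense_below_impl Dp => q _ [].
Qed.

Lemma forces_eq_refl x p : feq' x x p.
Proof.
elim: x p => A c a IH p /=.
by split=> i; apply: dense_below_all => q _ qi; exists i.
Qed.

Lemma forces_eq_sym x y p : feq' x y p -> feq' y x p.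
Proof.
elim: x y p => A c a IH [B d b] p /= [xy yx]; split=> k.
  apply: dense_below_impl (yx k) => q _ h /h[i [qi e]]; exists i; split => //.
  exact: IH.
apply: dense_below_impl (xy k) => q _ h /h[i [qi e]]; exists i; split => //.
exact: IH.
Qed.

Lemma forces_eq_trans x y z p : feq' x y p -> feq' y z p -> feq' x z p.
Proof.
elim: x y z p => A c a IH [B d b] [C e f] p /= [xy yx] [yz zy]; split=> k q qp.
  have [r rq xyr] := xy k _ qp.
  (* If [r] is not below [c k], the implication to be established at [r] is vacuous. *)
  have [rk|nrk] := pselect (le r (c k)); last by exists r.
  have [j [rj er]] := xyr rk.
  have [s sr yzs] := yz j _ (le_trans rq qp).
  have [l [sl es]] := yzs (le_trans sr rj).
  exists s; first exact: le_trans rq.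
  move=> _; exists l; split=> //; apply: IH es; exact: forces_eq_mono er.
have [r rq zyr] := zy k _ qp.
have [rk|nrk] := pselect (le r (e k)); last by exists r.
have [j [rj er]] := zyr rk.
have [s sr yxs] := yx j _ (le_trans rq qp).
have [l [sl es]] := yxs (le_trans sr rj).
exists s; first exact: le_trans rq.
move=> _; exists l; split=> //; apply: IH es _; exact: forces_eq_mono er.
Qed.

Lemma forces_mem_mono x y p q : le q p -> fmem' x y p -> fmem' x y q.
Proof. by case: y => B d b; exact: dense_below_mono. Qed.

Lemma forces_mem_dense x y p : dense_below p (fmem' x y) -> fmem' x y p.
Proof. by case: y => B d b; exact: dense_below_dense. Qed.

Lemma forces_mem_eqr x y y' p : feq' y y' p -> fmem' x y p -> fmem' x y' p.
Proof.
case: y y' => B d b [C e c] /= [yy' _] xy q qp.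
have [r rq [j [rj er]]] := xy _ qp.
have [s sr ys] := yy' j _ (le_trans rq qp).
have [k [sk es]] := ys (le_trans sr rj).
exists s; first exact: le_trans rq.
exists k; split=> //; apply: forces_eq_trans es; exact: forces_eq_mono er.
Qed.

(** The test names [w] that matter are the components [a k] and [b k]: each is forced into its own
    name below the condition attached to it. *)
Lemma forces_eq_ext x y p :
  (forall w q, le q p -> fmem' w x q <-> fmem' w y q) -> feq' x y p.
Proof.
case: x y => A c a [B d b] xy /=; split=> k q qp.
  have [qk|] := pselect (le q (c k)); last by exists q.
  have : fmem' (a k) (Name c a) q.
    apply: dense_below_all => r rq; exists k; split; last exact: forces_eq_refl.
    exact: le_trans qk.
  by move=> /(xy _ _ qp)/(_ _ (le_refl q))[r rq [j rj]]; exists r => // _; exists j.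
have [qk|] := pselect (le q (d k)); last by exists q.
have : fmem' (b k) (Name d b) q.
  apply: dense_below_all => r rq; exists k; split; last exact: forces_eq_refl.
  exact: le_trans qk.
move=> /(xy _ _ qp)/(_ _ (le_refl q))[r rq [j [rj e]]].
by exists r => // _; exists j; split=> //; exact: forces_eq_sym.
Qed.

(** Since [check] attaches every condition to every element, the side conditions in [forces_eq] can
    always be met, and what remains is the recursion defining [veq]. *)
Lemma forces_eq_check (s t : vset) p :
  feq' (check P s) (check P t) p <-> veq s t.
Proof.
elim: s t p => A a IH [B b] p /=; split=> -[st ts]; split.
- move=> i; have [q qp /(_ qp)[[j r] [_ /IH]]] := st (i, p) _ (le_refl p).
  by exists j.
- move=> j; have [q qp /(_ qp)[[i r] [_ /IH]]] := ts (j, p) _ (le_refl p).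
  by exists i.
- move=> [i r]; apply: dense_below_all => q _ _; have [j ij] := st i.
  by exists (j, q); split; [exact: le_refl|exact/IH].
- move=> [j r]; apply: dense_below_all => q _ _; have [i ij] := ts j.
  by exists (i, q); split; [exact: le_refl|exact/IH].
Qed.

Lemma forces_mem_check A (a : A -> vset) x p :
  fmem' x (check P (vsup a)) p <->
  dense_below p (fun q => exists i, feq' x (check P (a i)) q).
Proof.
split; apply: dense_below_impl => q _; first by case=> -[i r] [_ e]; exists i.
by case=> i e; exists (i, q); split=> //; exact: le_refl.
Qed.

Lemma forces_mono phi p q : le q p -> forces p phi -> forces q phi.
Proof.
elim: phi p q => [x y|x y|phi IH psi IH'|phi IH|phi IH] p q qp /=.
- exact: forces_mem_mono.
- exact: forces_eq_mono.
- by case=> /(IH _ _ qp)? /(IH' _ _ qp)?.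
- by move=> h r rq; apply: h; exact: le_trans qp.
- exact: dense_below_mono.
Qed.

Lemma forces_dense phi p : dense_below p (forces ^~ phi) -> forces p phi.
Proof.
elim: phi p => [x y|x y|phi IH psi IH'|phi IH|phi IH] p /=.
- exact: forces_mem_dense.
- exact: forces_eq_dense.
- move=> h; split; [apply: IH|apply: IH'].
    by apply: dense_below_impl h => q _ [].
  by apply: dense_below_impl h => q _ [].
- move=> h q qp fq; have [r rq hr] := h _ qp.
  by apply: (hr _ (le_refl r)); exact: forces_mono fq.
- exact: dense_below_dense.
Qed.

(** A condition with no extension forcing [phi] forces its negation, so the hypothesis makes forcing
    [phi] dense below [p]. The connectives defined through [fnot] get their expected meaning from
    this. *)
Lemma dense_notnot p phi :
  (forall q, le q p -> ~ forces q (fnot phi)) -> forces p phi.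
Proof.
move=> h; apply: forces_dense => q qp; apply: contrapT => nq.
by apply: (h q qp) => r rq fr; apply: nq; exists r.
Qed.

Lemma forces_all p phi : forces p (fall phi) <-> forall x, forces p (phi x).
Proof.
split=> [h x|h q qp /(_ _ (le_refl q))[r rq [x]]].
  apply: dense_notnot => q qp nq; apply: (h q qp).
  by apply: dense_below_all => r rq; exists x; exact: forces_mono nq.
move/(_ _ (le_refl r)); apply; apply: forces_mono (h x); exact: le_trans qp.
Qed.

Lemma forces_imp p phi psi :
  forces p (fimp phi psi) <-> forall q, le q p -> forces q phi -> forces q psi.
Proof.
split=> [h q qp fq|h q qp [fq /(_ _ (le_refl q))]]; last by apply; exact: h.
apply: dense_notnot => r rq nr; apply: (h r (le_trans rq qp)); split=> //.
exact: forces_mono fq.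
Qed.

Lemma forces_iff p phi psi :
  forces p (fiff phi psi) <-> forall q, le q p -> forces q phi <-> forces q psi.
Proof.
split=> [[/forces_imp h /forces_imp h'] q qp|h].
  by split; [exact: h|exact: h'].
by split; apply/forces_imp => q qp /(h q qp).
Qed.

Lemma forces_or p phi psi :
  forces p (for_ phi psi) <->
  dense_below p (fun q => forces q phi \/ forces q psi).
Proof.
split=> [h q qp|h q qp [n1 n2]].
  apply: contrapT => nq; apply: (h q qp); split=> r rq fr.
    by apply: nq; exists r => //; left.
  by apply: nq; exists r => //; right.
by have [r rq [/(n1 _ rq)|/(n2 _ rq)]] := h q qp.
Qed.

Lemma forces_ex_intro p (phi : name P -> formula (name P)) x :
  forces p (phi x) -> forces p (fex phi).
Proof.
by move=> h; apply: dense_below_all => q qp; exists x; exact: forces_mono h.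
Qed.

Lemma forces_ex_in p (phi : name P -> formula (name P)) x y :
  fmem' x y p -> forces p (phi x) -> forces p (fex_in y phi).
Proof. by move=> xy h; apply: (@forces_ex_intro _ _ x). Qed.

(** * Unordered and ordered pairs under forcing *)

Definition upair p z x y := forall w q, le q p ->
  fmem' w z q <-> dense_below q (fun r => feq' w x r \/ feq' w y r).

Lemma forces_upair p z x y : forces p (is_upair z x y) <-> upair p z x y.
Proof.
split=> [/forces_all h w q qp|h].
  by have /forces_iff/(_ _ qp) := h w; rewrite forces_or.
by apply/forces_all => w; apply/forces_iff => q qp; rewrite forces_or; exact: h.
Qed.

Lemma upair_mono p q z x y : le q p -> upair p z x y -> upair q z x y.
Proof. by move=> qp h w r rq; apply: h; exact: le_trans qp. Qed.

Lemma upair_eq p z z' x x' y y' : feq' z z' p -> feq' x x' p -> feq' y y' p ->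
  upair p z x y -> upair p z' x' y'.
Proof.
move=> zz' xx' yy' h w q qp.
have [zq [xq yq]] : feq' z z' q /\ feq' x x' q /\ feq' y y' q.
  by split; [|split]; apply: forces_eq_mono qp _.
split.
  move=> /(forces_mem_eqr (forces_eq_sym zq))/(h _ _ qp).
  apply: dense_below_impl => r rq -[] e; [left|right].
    by apply: forces_eq_trans e _; exact: forces_eq_mono xq.
  by apply: forces_eq_trans e _; exact: forces_eq_mono yq.
move=> wxy; apply: (forces_mem_eqr zq); apply/(h _ _ qp).
apply: dense_below_impl wxy => r rq -[] e; [left|right].
  by apply: forces_eq_trans e _; apply: forces_eq_sym; exact: forces_eq_mono xq.
by apply: forces_eq_trans e _; apply: forces_eq_sym; exact: forces_eq_mono yq.
Qed.

Lemma upair_meml p z x y : upair p z x y -> fmem' x z p.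
Proof.
move=> h; apply/(h _ _ (le_refl p)); apply: dense_below_all => q _.
by left; exact: forces_eq_refl.
Qed.

Lemma upair_memr p z x y : upair p z x y -> fmem' y z p.
Proof.
move=> h; apply/(h _ _ (le_refl p)); apply: dense_below_all => q _.
by right; exact: forces_eq_refl.
Qed.

Lemma upair_diag p z x w : upair p z x x -> fmem' w z p -> feq' w x p.
Proof.
move=> h /(h _ _ (le_refl p)) wx; apply: forces_eq_dense.
by apply: dense_below_impl wx => q _ [].
Qed.

(** Densely, [y] equals [x] or [y']. In the first case [y'], being in the pair of [x] and [y],
    equals [x] or [y], and these agree. *)
Lemma upair_inj p z x y y' : upair p z x y -> upair p z x y' -> feq' y y' p.
Proof.
move=> h h'; apply: forces_eq_dense => q qp.
have /(_ _ (le_refl q))[r rq [yx|yy']] :=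
  (h' y q qp).1 (forces_mem_mono qp (upair_memr h)); last by exists r.
have rp := le_trans rq qp.
have /(_ _ (le_refl r))[s sr [y'x|y'y]] :=
  (h y' r rp).1 (forces_mem_mono rp (upair_memr h')).
  exists s; first exact: le_trans rq.
  apply: (forces_eq_trans (forces_eq_mono sr yx)); exact: forces_eq_sym.
by exists s; [exact: le_trans rq|exact: forces_eq_sym].
Qed.

Lemma upair_ext p z z' x y : upair p z x y -> upair p z' x y -> feq' z z' p.
Proof.
by move=> h h'; apply: forces_eq_ext => w q qp; rewrite (h _ _ qp) (h' _ _ qp).
Qed.

(** Here a single condition decides the witnesses [u] and [v], whereas forcing [is_pair] provides
    them only densely. *)
Definition kpair p z x y :=
  exists u v, [/\ upair p u x x, upair p v x y & upair p z u v].

Lemma forces_pair p z x y :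
  forces p (is_pair z x y) <-> dense_below p (fun q => kpair q z x y).
Proof.
split=> [h|h].
  apply: dense_below_dense; apply: dense_below_impl h => q _ [u].
  apply: dense_below_impl => r _ [v].
  by case=> /forces_upair hu [/forces_upair hv /forces_upair hz]; exists u, v.
apply: forces_dense; apply: dense_below_impl h => q _ [u [v [hu hv hz]]].
apply: dense_below_all => r rq; exists u; apply: dense_below_all => s sr.
have sq := le_trans sr rq.
by exists v; split; [|split]; apply/forces_upair; apply: upair_mono sq _.
Qed.

(** Kuratowski's argument: the singleton [u] of [x] equals [u'] or [v'], both of which contain [x'],
    so [x] equals [x']. Then [upair_inj] is applied to the outer pairs and to [v]. *)
Lemma kpair_inj p z x y x' y' : kpair p z x y -> kpair p z x' y' ->
  feq' x x' p /\ feq' y y' p.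
Proof.
move=> [u [v [hu hv hz]]] [u' [v' [hu' hv' hz']]].
have xx' : feq' x x' p.
  apply: forces_eq_dense => q qp.
  have [r rq uu'] := (hz' u q qp).1 (forces_mem_mono qp (upair_meml hz)) _ (le_refl q).
  have rp := le_trans rq qp; exists r => //; apply: forces_eq_sym.
  apply: (upair_diag (upair_mono rp hu)).
  case: uu' => e; apply: (forces_mem_eqr (forces_eq_sym e)).
    exact: forces_mem_mono rp (upair_meml hu').
  exact: forces_mem_mono rp (upair_meml hv').
split=> //.
have x'x := forces_eq_sym xx'.
have uu' : feq' u u' p.
  apply: upair_ext hu _.
  exact: (upair_eq (forces_eq_refl _ _) x'x x'x hu').
have vv' : feq' v v' p.
  apply: upair_inj hz _.
  exact: (upair_eq (forces_eq_refl _ _) (forces_eq_sym uu') (forces_eq_refl _ _) hz').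
apply: upair_inj hv _.
exact: (upair_eq (forces_eq_sym vv') x'x (forces_eq_refl _ _) hv').
Qed.

Lemma kpair_eq p z z' x y : feq' z z' p -> kpair p z x y -> kpair p z' x y.
Proof.
move=> zz' [u [v [hu hv hz]]]; exists u, v; split=> //.
exact: upair_eq zz' (forces_eq_refl _ _) (forces_eq_refl _ _) hz.
Qed.

(** As in [check], each element is paired with every condition in place of a largest one. *)
Definition upair_name x y : name P :=
  Name (fun bp : bool * P => bp.2) (fun bp => if bp.1 then x else y).

Definition pair_name x y : name P := upair_name (upair_name x x) (upair_name x y).

Lemma upair_nameP p x y : upair p (upair_name x y) x y.
Proof.
move=> w q _; split; apply: dense_below_impl => r _.
  by case=> -[[] s] [_ e]; [left|right].
by case=> e; [exists (true, r)|exists (false, r)]; split=> //; exact: le_refl.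
Qed.

Lemma pair_nameP p x y : kpair p (pair_name x y) x y.
Proof.
by exists (upair_name x x), (upair_name x y); split; exact: upair_nameP.
Qed.

Lemma upair_name_eq p x x' y y' : feq' x x' p -> feq' y y' p ->
  feq' (upair_name x y) (upair_name x' y') p.
Proof.
move=> xx' yy'; apply: (upair_ext _ (@upair_nameP p x' y')).
exact: upair_eq (forces_eq_refl _ _) xx' yy' (@upair_nameP p x y).
Qed.

Lemma pair_name_eq p x x' y y' : feq' x x' p -> feq' y y' p ->
  feq' (pair_name x y) (pair_name x' y') p.
Proof. by move=> xx' yy'; apply: upair_name_eq; exact: upair_name_eq. Qed.

(** * A name for a surjection, from conditions that decide its values *)

Section Surjection.
Context (A B : Type) (a : A -> vset) (b : B -> vset) (M : A -> B -> P -> Prop).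
Hypothesis M_mono : forall i j p q, le q p -> M i j p -> M i j q.
Hypothesis M_fun : forall i i' j j' p,
  veq (a i) (a i') -> M i j p -> M i' j' p -> veq (b j) (b j').
Hypothesis M_total : forall i p, exists2 q, le q p & exists j, M i j q.
Hypothesis M_onto : forall j p, exists2 q, le q p & exists i, M i j q.

(** [M i j p] is read as: [p] decides the value at [a i] to be [b j]. Each such decision contributes
    its pair under the deciding condition. *)
Definition graph_name : name P :=
  Name (fun t : {t : A * B * P | M t.1.1 t.1.2 t.2} => (proj1_sig t).2)
       (fun t => pair_name (check P (a (proj1_sig t).1.1))
                           (check P (b (proj1_sig t).1.2))).

Lemma mem_graph_name p z : fmem' z graph_name p <->
  dense_below p (fun q => exists i j,
    M i j q /\ feq' z (pair_name (check P (a i)) (check P (b j))) q).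
Proof.
split; apply: dense_below_impl => q _.
  by move=> [[[[i j] r] /= Mr] [qr e]]; exists i, j; split=> //; exact: M_mono Mr.
move=> [i [j [Mq e]]].
by exists (exist _ (i, j, q) Mq); split=> //; exact: le_refl.
Qed.

Lemma maps_to_graph_name p x y i j : M i j p ->
  feq' x (check P (a i)) p -> feq' y (check P (b j)) p ->
  forces p (maps_to graph_name x y).
Proof.
move=> Mp xi yj; apply: dense_below_all => q qp; exists (pair_name x y); split.
  apply/mem_graph_name; apply: dense_below_all => r rq.
  have rp := le_trans rq qp; exists i, j; split; first exact: M_mono Mp.
  by apply: pair_name_eq; apply: forces_eq_mono rp _.
by apply/forces_pair; apply: dense_below_all => r _; exact: pair_nameP.
Qed.

Lemma maps_to_graph_nameE p x y : forces p (maps_to graph_name x y) ->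
  dense_below p (fun q => exists i j,
    [/\ M i j q, feq' x (check P (a i)) q & feq' y (check P (b j)) q]).
Proof.
move=> h; apply: dense_below_dense; apply: dense_below_impl h => q _ [z].
case=> /mem_graph_name zf /forces_pair zxy r rq.
have [s sr [i [j [Ms e]]]] := zf r rq.
have [t ts kz] := zxy s (le_trans sr rq).
exists t; first exact: le_trans sr.
exists i, j; have Mt := M_mono ts Ms.
have [] // := kpair_inj kz (kpair_eq (forces_eq_sym (forces_eq_mono ts e)) (pair_nameP t _ _)).
Qed.

Lemma forces_surjection :
  forced le (exists_surjection (check P (vsup a)) (check P (vsup b))).
Proof.
have mem_chk (C : Type) (c : C -> vset) i p x :
    feq' x (check P (c i)) p -> fmem' x (check P (vsup c)) p.
  move=> e; apply/forces_mem_check; apply: dense_below_all => q qp.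
  by exists i; exact: forces_eq_mono e.
have in_intro (C : Type) (c : C -> vset) i p phi : forces p (phi (check P (c i))) ->
    forces p (fex_in (check P (vsup c)) phi).
  by apply: forces_ex_in; exact/mem_chk/forces_eq_refl.
suff h p : [/\ forces p (fall_in graph_name (fun z =>
      fex_in (check P (vsup a)) (fun x => fex_in (check P (vsup b)) (is_pair z x)))),
    forces p (fall_in (check P (vsup a)) (fun x => fex_in (check P (vsup b)) (fun y =>
      fand (maps_to graph_name x y)
        (fall (fun y' => fimp (maps_to graph_name x y') (feq y' y)))))) &
    forces p (fall_in (check P (vsup b)) (fun y =>
      fex_in (check P (vsup a)) (fun x => maps_to graph_name x y)))].
  by move=> p; apply: (@forces_ex_intro _ _ graph_name); have [] := h p.
split.
- apply/forces_all => z; apply/forces_imp => q _ /mem_graph_name zf.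
  apply: forces_dense; apply: dense_below_impl zf => r _ [i [j [_ e]]].
  apply: (in_intro); apply: (in_intro); apply/forces_pair.
  apply: dense_below_all => s sr; apply: kpair_eq (@pair_nameP _ _ _).
  by apply: forces_eq_sym; exact: forces_eq_mono e.
- apply/forces_all => x; apply/forces_imp => q _ /forces_mem_check xa.
  apply: forces_dense; apply: dense_below_dense.
  apply: dense_below_impl xa => r _ [i e] s sr.
  have [t ts [j Mt]] := M_total i s; exists t => //.
  have tr := le_trans ts sr; have et := forces_eq_mono tr e.
  apply: (in_intro); split; first exact: maps_to_graph_name Mt et (forces_eq_refl _ _).
  apply/forces_all => y; apply/forces_imp => u ut /maps_to_graph_nameE xy.
  apply: forces_eq_dense; apply: dense_below_impl xy => v vu [i' [j' [Mv e' ey]]].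
  (* Both values are ground model sets, so their equality is a matter of [veq], which [M_fun]
     settles once both decisions hold at [v]. *)
  apply: forces_eq_trans ey _; apply/forces_eq_check.
  have vt := le_trans vu ut.
  apply: M_fun Mv (M_mono vt Mt); apply/(forces_eq_check _ _ v).
  exact: forces_eq_trans (forces_eq_sym e') (forces_eq_mono vt et).
- apply/forces_all => y; apply/forces_imp => q _ /forces_mem_check yb.
  apply: forces_dense; apply: dense_below_dense.
  apply: dense_below_impl yb => r _ [j e] s sr.
  have [t ts [i Mt]] := M_onto j s; exists t => //.
  apply: (in_intro); apply: maps_to_graph_name Mt (forces_eq_refl _ _) _.
  by apply: forces_eq_mono e; exact: le_trans sr.
Qed.

End Surjection.

(* Where [M] leaves the value at [i] undecided, the constructed function takes
   the default value [b j0]. *)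
Lemma forces_surjection_of_partial (A B : Type) (a : A -> vset) (b : B -> vset)
    (j0 : B) (M : A -> B -> P -> Prop) :
  (forall i j p q, le q p -> M i j p -> M i j q) ->
  (forall i i' j j' p, veq (a i) (a i') -> M i j p -> M i' j' p -> j = j') ->
  (forall j p, exists2 q, le q p & exists i, M i j q) ->
  forced le (exists_surjection (check P (vsup a)) (check P (vsup b))).
Proof.
move=> M_mono M_fun M_onto.
(* Distinct indices may denote the same set, so [M] is first closed under [veq] in its argument. In
   [N] the default is taken only if no extension defines a value, which keeps [N] monotone and
   single-valued. *)
pose defined i j q := exists i', veq (a i) (a i') /\ M i' j q.
pose N i j q := defined i j q \/ j = j0 /\ forall r k, le r q -> ~ defined i k r.
have d_mono i j p q : le q p -> defined i j p -> defined i j q.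
  by move=> qp [i' [e Mp]]; exists i'; split=> //; exact: M_mono Mp.
have d_eq i i' j p : veq (a i) (a i') -> defined i j p -> defined i' j p.
  by move=> e [k [ek Mp]]; exists k; split=> //; exact: veq_trans (veq_sym e) ek.
apply: (@forces_surjection _ _ _ _ N).
- move=> i j p q qp [dp|[-> h]]; first by left; exact: d_mono dp.
  by right; split=> // r k rq; apply: h; exact: le_trans qp.
- move=> i i' j j' p ii' [dp|[-> h]] [dp'|[-> h']] //.
  + have [[k [ek Mk]] [k' [ek' Mk']]] := (d_eq _ _ _ _ ii' dp, dp').
    rewrite (M_fun _ _ _ _ _ (veq_trans (veq_sym ek) ek') Mk Mk'); exact: veq_refl.
  + by case: (h' _ j (le_refl p)); exact: d_eq dp.
  + by case: (h _ j' (le_refl p)); apply: d_eq dp'; exact: veq_sym.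
  + exact: veq_refl.
- move=> i p.
  have [[q qp [j dq]]|h] := pselect (exists2 q, le q p & exists j, defined i j q).
    by exists q => //; exists j; left.
  exists p => //; exists j0; right; split=> // r k rp dr.
  by apply: h; exists r => //; exists k.
- move=> j p; have [q qp [i Mq]] := M_onto j p.
  exists q => //; exists i; left; exists i; split=> //; exact: veq_refl.
Qed.

End ForcingTheory.

(** * Infinite sets of natural numbers and their topology *)

Local Open Scope classical_set_scope.

Definition infset_of (f : nat -> nat) (f_incr : increasing_functions f) : infset :=
  exist _ f (mem_set f_incr).

Lemma infset_incr (x : infset) : {homo (set_val x : nat -> nat) : m n / (m < n)%N}.
Proof. exact: (set_valP x). Qed.

Lemma infset_leq (x : infset) : {homo (set_val x : nat -> nat) : m n / (m <= n)%N}.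
Proof.
by move=> m n; rewrite leq_eqVlt => /predU1P[->//|/(infset_incr x)/ltnW].
Qed.

Lemma infset_ge (x : infset) n : (n <= (set_val x : nat -> nat) n)%N.
Proof. elim: n => // n IH; exact: leq_ltn_trans IH (infset_incr x (ltnSn n)). Qed.

Lemma finite_set_natP (Z : set nat) :
  finite_set Z <-> exists n, forall i, Z i -> (i < n)%N.
Proof.
split=> [|[n Zn]]; last exact: sub_finite_set (finite_II n).
rewrite finite_seqP => -[s ->]; exists (\max_(i <- s) i).+1 => i /= si.
by rewrite ltnS; exact: leq_bigmax_seq.
Qed.

Lemma infinite_set_natP (Z : set nat) :
  infinite_set Z <-> forall n, exists2 i, Z i & (n <= i)%N.
Proof.
split=> [nZ n|h /finite_set_natP[n Zn]].
  apply: contrapT => nh; apply: nZ; apply/finite_set_natP; exists n => i Zi.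
  by rewrite ltnNge; apply/negP => ni; apply: nh; exists i.
by have [i /Zn] := h n; rewrite ltnNge => /negP.
Qed.

Lemma elements_infinite (x : infset) : infinite_set (elements x).
Proof.
apply/infinite_set_natP => n; exists ((set_val x : nat -> nat) n).
  by exists n.
exact: infset_ge.
Qed.

Lemma infset_enum (Z : set nat) : infinite_set Z -> exists x : infset, elements x = Z.
Proof.
move=> /infinite_set_natP Zinf.
have /choice[nxt nxtP] n : exists m,
    [/\ Z m, (n <= m)%N & forall k, Z k -> (n <= k)%N -> (m <= k)%N].
  have ex : exists m, `[< Z m /\ (n <= m)%N >].
    by have [m Zm nm] := Zinf n; exists m; apply/asboolP.
  exists (ex_minn ex); case: ex_minnP => m /asboolP[? ?] hm; split=> // k Zk nk.
  by apply: hm; apply/asboolP.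
pose f := fix f n := if n is m.+1 then nxt (f m).+1 else nxt 0.
have f_incr : increasing_functions f.
  apply: homo_ltn => [y x z|n]; first exact: ltn_trans.
  by have [] := nxtP (f n).+1.
exists (infset_of f_incr); apply/seteqP; split=> [_ [n _ <-]|z Zz].
  by rewrite /=; case: n => [|n] /=; [have [] := nxtP 0|have [] := nxtP (f n).+1].
(* The least [n] with [z <= f n] gives equality, as [nxt] never jumps over a member of [Z]. *)
have fz : exists n, (z <= f n)%N by exists z; exact: (infset_ge (infset_of f_incr)).
case: (ex_minnP fz) => n zn nmin; exists n => //.
apply/eqP; rewrite eqn_leq zn andbT; case: n zn nmin => [|n] zn nmin /=.
  by have [_ _ ->] := nxtP 0.
have [_ _ ->//] := nxtP (f n).+1.
by rewrite ltnNge; apply/negP => /nmin; rewrite ltnn.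
Qed.

Lemma elements_agree (x y : infset) n :
  (forall i, (i < n)%N -> (set_val y : nat -> nat) i = (set_val x : nat -> nat) i) ->
  forall i, (i < n)%N -> elements y i <-> elements x i.
Proof.
move=> xy i ilt; split=> -[k _ ki]; exists k => //.
  by rewrite -xy//; apply: leq_ltn_trans ilt; rewrite -ki; exact: infset_ge.
by rewrite xy//; apply: leq_ltn_trans ilt; rewrite -ki; exact: infset_ge.
Qed.

(** At a first disagreement [i], the smaller of the two values belongs to the other set as well,
    where it must be the value at some [k < i]; by induction both enumerations take it at [k],
    against strict monotonicity. *)
Lemma agree_elements (x y : infset) n :
  (forall i, (i <= (set_val x : nat -> nat) n)%N -> elements y i <-> elements x i) ->
  forall i, (i <= n)%N -> (set_val y : nat -> nat) i = (set_val x : nat -> nat) i.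
Proof.
move=> xy; elim/ltn_ind => i IH ilen.
case: (ltngtP ((set_val y : nat -> nat) i) ((set_val x : nat -> nat) i)) => // lt_i.
  have /xy[+ _] : ((set_val y : nat -> nat) i <= (set_val x : nat -> nat) n)%N.
    by apply: leq_trans (ltnW lt_i) _; exact: infset_leq.
  case; first by exists i.
  move=> k _ xk; have ki : (k < i)%N.
    rewrite ltnNge; apply/negP => /(infset_leq x); rewrite xk leqNgt lt_i//.
  have := infset_incr y ki.
  by rewrite IH// ?xk ?ltnn//; exact: leq_trans (ltnW ki) _.
have /xy[_ +] : ((set_val x : nat -> nat) i <= (set_val x : nat -> nat) n)%N.
  exact: infset_leq.
case; first by exists i.
move=> k _ yk; have ki : (k < i)%N.
  rewrite ltnNge; apply/negP => /(infset_leq y); rewrite yk leqNgt lt_i//.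
have := infset_incr x ki.
by rewrite -IH// ?yk ?ltnn//; exact: leq_trans (ltnW ki) _.
Qed.

Lemma nbhs_baire (f : baire) (A : set baire) : nbhs f A <->
  exists n, forall g : baire, (forall i, (i < n)%N -> g i = f i) -> A g.
Proof.
split=> [fA|[n nA]]; last first.
  apply: (@filterS _ _ _ [set g : baire | forall i, (i < n)%N -> g i = f i]) => //.
  elim: n {nA} => [|n IH]; first by apply: filterS filterT.
  have fn : nbhs f [set g : baire | g n = f n].
    have /= := (@proj_continuous nat (fun _ => nat) n f) [set f n].
    by apply; exact: discrete_set1.
  apply: filterS (filterI IH fn) => g /= [gi gn] i.
  by rewrite ltnS leq_eqVlt => /predU1P[->//|]; exact: gi.
(* The filter generated by the cylinders at [f] converges to [f] because it does so in each
   coordinate. *)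
pose F : set_system baire := [set A : set baire |
  exists n, forall g : baire, (forall i, (i < n)%N -> g i = f i) -> A g].
have FF : Filter F.
  split=> [|C D [m mC] [n nD]|C D CD [n nC]]; first by exists 0.
    exists (maxn m n) => g gf; split; [apply: mC|apply: nD] => i ilt; apply: gf.
      by rewrite leq_max ilt.
    by rewrite leq_max ilt orbT.
  by exists n => g /nC/CD.
suff h : cvg_to F (nbhs (f : {ptws nat -> nat})) by exact: (h A fA).
apply/cvg_sup => i C [_ [[V _ <-] Vf VC]].
by exists i.+1 => g /(_ i (ltnSn i)) gf; apply: VC; rewrite /= gf.
Qed.

Lemma nbhs_infset_val (x : infset) (A : set infset) : nbhs x A <->
  exists n, forall y : infset,
    (forall i, (i < n)%N -> (set_val y : nat -> nat) i = (set_val x : nat -> nat) i) -> A y.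
Proof.
split=> [[_ [[V oV <-] Vx VA]]|[n nA]].
  have /nbhs_baire[n nV] : nbhs (set_val x : baire) V by exact: open_nbhs_nbhs.
  by exists n => y xy; apply: VA; exact: nV.
have xV : nbhs (set_val x : baire)
    [set g : baire | forall i, (i < n)%N -> g i = (set_val x : baire) i].
  by apply/nbhs_baire; exists n.
have xU : nbhs x (set_val @^-1` [set g : baire |
    forall i, (i < n)%N -> g i = (set_val x : baire) i]).
  exact: (@initial_continuous infset baire set_val x _ xV).
by apply: filterS xU => y; exact: nA.
Qed.

(** The topology given by enumerations coincides with the one given by characteristic functions,
    which suits the constructions with finite 0-1 patterns. *)
Lemma nbhs_infset (x : infset) (A : set infset) : nbhs x A <->
  exists n, forall y : infset,
    (forall i, (i < n)%N -> elements y i <-> elements x i) -> A y.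
Proof.
rewrite nbhs_infset_val; split=> -[n nA].
  exists ((set_val x : nat -> nat) n).+1 => y xy; apply: nA => i ilt.
  by apply: (agree_elements (n := n)) => [j jx|]; [exact: xy|exact: ltnW].
by exists n => y /elements_agree/nA.
Qed.

(** * Regular filters *)

Definition eventually_meets (Z : set nat) (h : nat -> nat) :=
  exists m, forall n, (m <= n)%N -> exists i, [/\ Z i, (n <= i)%N & (i < h n)%N].

(** On each compact piece every coordinate is bounded. A diagonal maximum of these bounds eventually
    bounds the enumeration of each [x], whose [k]-th element is also at least [k]. *)
Lemma sigma_compact_eventually_meets (K : set infset) : sigma_compact K ->
  exists h, forall x, K x -> eventually_meets (elements x) h.
Proof.
move=> [C [C_compact ->]].
have /choice[f fP] n : exists f : nat -> nat, forall k (x : infset), C n x ->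
    ((set_val x : nat -> nat) k <= f k)%N.
  suff /choice[f fP] k : exists N, forall x : infset, C n x ->
      ((set_val x : nat -> nat) k <= N)%N by exists f.
  have /compact_near_coveringP := C_compact n.
  move=> /(_ nat \oo (fun N x => ((set_val x : nat -> nat) k <= N)%N)).
  case=> [x _|N _ /(_ N (leqnn N)) CN]; last by exists N.
  exists ([set y : infset | (set_val y : nat -> nat) k = (set_val x : nat -> nat) k],
          [set N | ((set_val x : nat -> nat) k <= N)%N]) => /=.
    split; first by apply/nbhs_infset_val; exists k.+1 => y; exact.
    exact: nbhs_infty_ge.
  by case=> y N /= [->].
exists (fun k => (\max_(n < k.+1) f n k).+1) => x [n _ Cnx].
exists n => k nk; exists ((set_val x : nat -> nat) k).
split; [by exists k|exact: infset_ge|].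
rewrite ltnS; apply: leq_trans (fP n k x Cnx) _.
have nk' : (n < k.+1)%N by [].
exact: (@leq_bigmax _ (fun i : 'I_k.+1 => f i k) (Ordinal nk')).
Qed.

Lemma nowhere_dense_extend (F : set infset) (m : nat) (p : nat -> bool) :
  nowhere_dense F -> exists m' q,
  [/\ forall i, (i < m)%N -> q i = p i,
      exists i, [/\ (m <= i)%N, (i < m')%N & q i] &
      forall x : infset, (forall i, (i < m')%N -> elements x i <-> q i) -> ~ F x].
Proof.
move=> F_nd.
(* [Z] follows [p] below [m] and contains everything from [m] on, hence is infinite. *)
pose Z := [set i | (i < m)%N -> p i].
have Zinf : infinite_set Z.
  apply/infinite_set_natP => n; exists (maxn m n); last exact: leq_maxr.
  by rewrite /Z /= ltnNge leq_maxl.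
have [x0 x0Z] := infset_enum Zinf.
have [x1 x1x0 x1F] : exists2 x1 : infset,
    forall i, (i < m)%N -> elements x1 i <-> elements x0 i & ~ closure F x1.
  apply: contrapT => h; suff : interior (closure F) x0 by rewrite F_nd.
  apply/nbhs_infset; exists m => y yx0; apply: contrapT => nFy.
  by apply: h; exists y.
have [B x1B FB] : exists2 B, nbhs x1 B & F `&` B = set0.
  apply: contrapT => h; apply: x1F => B x1B; apply/set0P/eqP => FB.
  by apply: h; exists B.
have /nbhs_infset[n nB] := x1B.
have [i x1i mi] := (infinite_set_natP _).1 (@elements_infinite x1) m.
(* Length [n] secures the neighbourhood of [x1] missing [F]; length [i.+1] secures an element at or
   after [m]. *)
exists (maxn n i.+1), (fun j => if (j < m)%N then p j else `[< elements x1 j >]).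
split.
- by move=> j ->.
- exists i; split=> //; first by rewrite leq_max ltnSn orbT.
  by rewrite ltnNge mi /=; apply/asboolP.
move=> x xq Fx; suff : (F `&` B) x by rewrite FB.
split=> //; apply: nB => j jn; rewrite xq ?leq_max ?jn//.
case: ifPn => jm; last by split=> /asboolP.
rewrite (x1x0 _ jm) x0Z /Z /=; split; first by move=> ->.
exact.
Qed.

(** The requirements in [l] are met one after the other: each overwrites the first [n] positions by
    [s t] and lengthens the common pattern, which preserves the earlier ones. *)
Lemma nowhere_dense_extend_seq (T : eqType) (l : seq T) (F : T -> set infset)
    (s : T -> nat -> bool) (n m : nat) (p : nat -> bool) :
  (n <= m)%N -> (forall t, nowhere_dense (F t)) -> exists m' q,
  [/\ (m <= m')%N, forall i, (i < m)%N -> q i = p i &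
      forall t (x : infset), t \in l ->
      (forall i, (i < m')%N -> elements x i <-> if (i < n)%N then s t i else q i) ->
      ~ F t x].
Proof.
move=> nm F_nd; elim: l => [|t l [m' [q [mm' qp qF]]]]; first by exists m, p.
have := @nowhere_dense_extend (F t) m' (fun i => if (i < n)%N then s t i else q i) (F_nd t).
move=> [m2 [r [rq [j [m'j jm2 _]] rF]]].
exists m2, (fun i => if (i < m')%N then q i else r i).
have m'm2 : (m' <= m2)%N by exact: leq_trans (ltnW jm2).
split; first exact: leq_trans mm' _.
  by move=> i im; rewrite (leq_trans im mm') qp.
move=> u x; rewrite inE => /predU1P[->|ul] xq.
  apply: rF => i im2; rewrite xq//.
  have [im'|m'i] := ltnP i m'; first by rewrite rq.
  by rewrite ltnNge (leq_trans nm (leq_trans mm' m'i)).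
apply: (qF u x ul) => i im'; by rewrite xq ?im' // (leq_trans im').
Qed.

Lemma nowhere_dense_block (F : nat -> set infset) (n : nat) :
  (forall k, nowhere_dense (F k)) -> exists m q, (n < m)%N /\
  forall k (x : infset), (k <= n)%N ->
  (forall i, (n <= i)%N -> (i < m)%N -> elements x i <-> q i) -> ~ F k x.
Proof.
move=> F_nd; pose T := ({ffun 'I_n -> bool} * 'I_n.+1)%type.
pose s (t : T) i := if insub i is Some j then t.1 j else false.
(* There is one requirement for each 0-1 pattern below [n] and each of the first [n.+1] sets.
   Starting from length [n.+1] makes the block nonempty. *)
have [m [q [nm _ qF]]] := @nowhere_dense_extend_seq _ (enum {: {ffun 'I_n -> bool} * 'I_n.+1}) (fun t => F t.2) s
  n n.+1 (fun _ => false) (leqnSn n) (fun t => F_nd t.2).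
exists m, q; split=> // k x kn xq.
have kn' : (k < n.+1)%N by [].
apply: (qF ([ffun i : 'I_n => `[< elements x i >]], Ordinal kn')).
  exact: mem_enum.
move=> i im; have [ilt|nlei] := ltnP i n; last exact: xq.
rewrite /s insubT /= ffunE /=; by split=> /asboolP.
Qed.

Lemma ltn_homo_ge (a : nat -> nat) (n : nat) :
  (forall k, (a k < a k.+1)%N) -> (n <= a n)%N.
Proof. by move=> h; elim: n => // n /leq_ltn_trans; apply. Qed.

Lemma ltn_homo_leq (a : nat -> nat) :
  (forall k, (a k < a k.+1)%N) -> {homo a : i j / (i <= j)%N}.
Proof.
move=> h; apply: homo_leq => [//|y x z|n]; first exact: leq_trans.
exact: ltnW.
Qed.

Lemma ltn_homo_locate (a : nat -> nat) (i : nat) :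
  (forall k, (a k < a k.+1)%N) -> (a 0 <= i)%N ->
  exists k, (a k <= i)%N /\ (i < a k.+1)%N.
Proof.
move=> a_lt a0; have ex : exists k, (i < a k)%N.
  by exists i.+1; exact: ltn_homo_ge.
case: (ex_minnP ex) => -[|k] ik kmin; first by rewrite ltnNge a0 in ik.
exists k; split=> //; rewrite leqNgt; apply/negP => /kmin.
by rewrite ltnn.
Qed.

(* Talagrand's characterization of meager filters; only the closure of [E]
   under supersets is needed here. *)
Lemma meager_eventually_meets (E : set infset) :
  (forall x y, E x -> elements x `<=` elements y -> E y) -> meager E ->
  exists h, forall x, E x -> eventually_meets (elements x) h.
Proof.
move=> E_up [F [F_nd EF]].
have /choice[H] n := nowhere_dense_block n F_nd.
move=> /choice[q qP].
pose a := fix a n := if n is k.+1 then H (a k) else 0.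
have a_lt k : (a k < a k.+1)%N by have [] := qP (a k).
(* As [n <= a n], the block from [a n] to [a n.+1] lies within the interval from [n] to [h n], so a
   failure of the conclusion yields infinitely many blocks missed by [x]. *)
exists (fun n => a n.+1) => x Ex; apply: contrapT => nx.
pose misses n := forall i, elements x i -> ~~ ((a n <= i) && (i < a n.+1))%N.
have xmiss m : exists2 n, (m <= n)%N & misses n.
  apply: contrapT => h; apply: nx; exists m => n mn; apply: contrapT => nn.
  apply: h; exists n => // i xi; apply/negP => /andP[ani ian]; apply: nn.
  by exists i; split=> //; apply: leq_trans ani; exact: ltn_homo_ge.
(* Adding the avoiding pattern on every missed block gives a superset of [x], hence a member of [E]
   and of some [F k]; yet its pattern on a missed block of index at least [k] keeps it out of
   [F k]. *)
pose Z := elements x `|`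
  [set i | exists n, [/\ misses n, (a n <= i)%N, (i < a n.+1)%N & q (a n) i]].
have [y yZ] : exists y : infset, elements y = Z.
  apply: infset_enum; apply: sub_infinite_set (@elements_infinite x).
  by move=> i; left.
have [k _ Fky] : (\bigcup_n F n) y.
  by apply/EF/(E_up x) => //; rewrite yZ => i; left.
have [n kn mn] := xmiss k.
have [_ /(_ k y)] := qP (a n); apply=> //.
  by apply: leq_trans kn _; exact: ltn_homo_ge.
move=> i ani ian; rewrite yZ; split=> [[xi|[n' [_ an'i ian' qi]]]|qi].
- by have := mn i xi; rewrite ani ian.
- suff -> : n = n' by [].
  apply/eqP; rewrite eqn_leq; apply/andP; split; rewrite leqNgt; apply/negP.
    move=> /(ltn_homo_leq a_lt)/(leq_trans ian'); rewrite ltnNge ani//.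
  by move=> /(ltn_homo_leq a_lt)/(leq_trans ian); rewrite ltnNge an'i.
by right; exists n.
Qed.

(** * Almost disjoint elements of non-meager and superperfect sets *)

Lemma comeager_almost_disjoint (F : nat -> set infset) (x0 : infset) (n0 : nat) :
  (forall k, nowhere_dense (F k)) -> exists x y : infset,
  [/\ forall k, ~ F k x /\ ~ F k y,
      forall i, (i < n0)%N -> elements x i <-> elements x0 i,
      forall i, (i < n0)%N -> elements y i <-> elements x0 i &
      finite_set (elements x `&` elements y)].
Proof.
move=> F_nd.
(* A stage consists of a length and approximations to [x] and [y] of that length. Stage [k] puts
   both outside [F k], adds a point to each, and adds no common point. *)
pose good k (u v : nat * ((nat -> bool) * (nat -> bool))) :=
  [/\ forall i, (i < u.1)%N -> v.2.1 i = u.2.1 i /\ v.2.2 i = u.2.2 i,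
      exists i, [/\ (u.1 <= i)%N, (i < v.1)%N & v.2.1 i],
      exists i, [/\ (u.1 <= i)%N, (i < v.1)%N & v.2.2 i],
      forall i, (u.1 <= i)%N -> (i < v.1)%N -> ~~ (v.2.1 i && v.2.2 i) &
      forall x : infset, ((forall i, (i < v.1)%N -> elements x i <-> v.2.1 i) \/
        (forall i, (i < v.1)%N -> elements x i <-> v.2.2 i)) -> ~ F k x].
have /choice[step stepP] (ku : nat * (nat * ((nat -> bool) * (nat -> bool)))) :
    exists v, good ku.1 ku.2 v.
  case: ku => k [m [p q]].
  have [m1 [p1 [p1p [i1 [mi1 i1m1 p1i1]] p1F]]] := nowhere_dense_extend m p (F_nd k).
  (* The second set stays empty from [m] to [m1], where the first one was extended; from [m1] to
     [m2] the roles are exchanged. *)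
  have [m2 [q2 [q2q [i2 [m1i2 i2m2 q2i2]] q2F]]] :=
    nowhere_dense_extend m1 (fun i => (i < m)%N && q i) (F_nd k).
  have mm1 : (m < m1)%N by exact: leq_ltn_trans mi1 i1m1.
  have m12 : (m1 < m2)%N by exact: leq_ltn_trans m1i2 i2m2.
  exists (m2, ((fun i => (i < m1)%N && p1 i), q2)); split=> /=.
  - by move=> i im; have im1 := ltn_trans im mm1; rewrite q2q// im1 im p1p.
  - by exists i1; rewrite i1m1; split=> //; exact: ltn_trans m12.
  - by exists i2; split=> //; exact: leq_trans (ltnW mm1) _.
  - move=> i mi im2; have [im1|//] := ltnP i m1.
    by rewrite q2q// ltnNge mi andbF.
  - move=> x [] xp; last exact: q2F.
    by apply: p1F => i im1; rewrite xp ?im1// (ltn_trans im1).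
pose u := fix u k := if k is k'.+1 then step (k', u k')
  else (n0, ((fun i => `[< elements x0 i >]), (fun i => `[< elements x0 i >]))).
have uP k : good k (u k) (u k.+1) := stepP (k, u k).
have m_lt k : ((u k).1 < (u k.+1).1)%N.
  by have [_ [i [ki ik _]] _ _ _] := uP k; exact: leq_ltn_trans ki ik.
have u_stable k l i : (k <= l)%N -> (i < (u k).1)%N ->
    (u l).2.1 i = (u k).2.1 i /\ (u l).2.2 i = (u k).2.2 i.
  move=> /subnK <-; elim: (l - k)%N => // d IH ik; rewrite addSn.
  have [/(_ i)[]] := uP (d + k)%N.
    apply: leq_trans ik _; exact: (ltn_homo_leq (a := fun k => (u k).1) m_lt (leq_addl _ _)).
  by move=> -> -> _ _ _ _; exact: IH.
(* [pr] will be [fst] or [snd]. Position [i] of the limit is read off stage [i.+1], whose length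
   exceeds [i]. *)
have lim_ex (pr : (nat -> bool) * (nat -> bool) -> nat -> bool) :
    (forall k l i, (k <= l)%N -> (i < (u k).1)%N -> pr (u l).2 i = pr (u k).2 i) ->
    (forall k, exists i, [/\ ((u k).1 <= i)%N, (i < (u k.+1).1)%N & pr (u k.+1).2 i]) ->
    exists x : infset, forall k i, (i < (u k).1)%N -> elements x i <-> pr (u k).2 i.
  move=> pr_stable pr_inf; pose Z := [set i | pr (u i.+1).2 i].
  have ui i : (i < (u i.+1).1)%N.
    exact: (@ltn_homo_ge (fun k => (u k).1) i.+1 m_lt).
  have ZE k i : (i < (u k).1)%N -> pr (u i.+1).2 i = pr (u k).2 i.
    move=> ik; have [h|/ltnW h] := leqP k i.+1; first exact: pr_stable.
    by rewrite (pr_stable _ _ _ h).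
  have [x xZ] : exists x : infset, elements x = Z.
    apply: infset_enum; apply/infinite_set_natP => n.
    have [i [ni ik pi]] := pr_inf n; exists i; first by rewrite /Z /= (ZE _ _ ik).
    apply: leq_trans ni; exact: (@ltn_homo_ge (fun k => (u k).1) n m_lt).
  by exists x => k i ik; rewrite xZ /Z /= (ZE _ _ ik).
have [x xP] := lim_ex fst (fun k l i kl ik => (u_stable k l i kl ik).1)
  (fun k => let: And5 _ h _ _ _ := uP k in h).
have [y yP] := lim_ex snd (fun k l i kl ik => (u_stable k l i kl ik).2)
  (fun k => let: And5 _ _ h _ _ := uP k in h).
exists x, y; split.
- move=> k; have [_ _ _ _ h] := uP k.
  by split; apply: h; [left|right] => i; [exact: xP|exact: yP].
- by move=> i /(xP 0) ->; split=> /asboolP.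
- by move=> i /(yP 0) ->; split=> /asboolP.
apply/finite_set_natP; exists n0 => i [xi yi]; rewrite ltnNge; apply/negP => ni.
have [k [ki ik]] := @ltn_homo_locate (fun k => (u k).1) i m_lt ni.
have [_ _ _ /(_ i ki ik)/negP + _] := uP k; apply.
by apply/andP; split; [exact/xP|exact/yP].
Qed.

Lemma chain_branch (s : nat -> seq nat) :
  (forall k, prefix (s k) (s k.+1) /\ (size (s k) < size (s k.+1))%N) ->
  exists f : nat -> nat, forall k i, (i < size (s k))%N -> f i = nth 0 (s k) i.
Proof.
move=> sP; have s_lt k : (size (s k) < size (s k.+1))%N by case: (sP k).
exists (fun i => nth 0 (s i.+1) i) => k i ik.
have si : (i < size (s i.+1))%N by exact: (@ltn_homo_ge (fun k => size (s k)) i.+1).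
have stable l d : (i < size (s l))%N -> nth 0 (s (d + l)) i = nth 0 (s l) i.
  move=> il; elim: d => // d IH; rewrite addSn -IH.
  have [/prefixP[t ->] _] := sP (d + l); rewrite nth_cat ifT//.
  apply: leq_trans il _.
  exact: (ltn_homo_leq (a := fun k => size (s k)) s_lt (leq_addl _ _)).
have [h|/ltnW h] := leqP k i.+1; first by rewrite -(subnK h) stable.
by rewrite -(subnK h) stable.
Qed.

(** Two branches are built through splitting nodes in turn: each time one of them is continued, its
    next value is chosen above all values the other has so far. *)
Lemma superperfect_almost_disjoint (S : set baire) : superperfect S ->
  S `<=` increasing_functions ->
  exists f g : baire, [/\ S f, S g & finite_set (range f `&` range g)].
Proof.
move=> [T [T_tree [s0 Ts0] T_split ->]] S_incr.
pose splits s := T s /\ infinite_set [set n | T (rcons s n)].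
have split_above s : T s -> exists t, splits t /\ prefix s t.
  by move=> /T_split[t [Tt st tinf]]; exists t.
have extend s N : splits s -> exists n t,
    [/\ (N <= n)%N, splits t & prefix (rcons s n) t].
  move=> [_ /infinite_set_natP/(_ N)[n Tn Nn]].
  by have [t [tsp nt]] := split_above _ Tn; exists n, t.
have [r0 [r0sp _]] := split_above _ Ts0.
pose good (u v : {s | splits s} * {s | splits s}) := exists n n',
  [/\ prefix (rcons (sval u.1) n) (sval v.1), prefix (rcons (sval u.2) n') (sval v.2),
      forall i, i \in sval u.2 -> (i < n)%N & forall i, i \in sval v.1 -> (i < n')%N].
have /choice[step stepP] u : exists v, good u v.
  case: u => -[s ssp] [t tsp].
  have [n [s' [tn s'sp ss']]] := extend s (\max_(i <- t) i).+1 ssp.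
  have [n' [t' [sn' t'sp tt']]] := extend t (\max_(i <- s') i).+1 tsp.
  exists (exist _ s' s'sp, exist _ t' t'sp), n, n'; split=> //= i ii.
    by apply: leq_trans tn; rewrite ltnS; exact: leq_bigmax_seq.
  by apply: leq_trans sn'; rewrite ltnS; exact: leq_bigmax_seq.
pose u := fix u k := if k is k'.+1 then step (u k') else
  (exist _ r0 r0sp, exist _ r0 r0sp).
have uP k : good (u k) (u k.+1) := stepP (u k).
have rcons_chain (s t : seq nat) n : prefix (rcons s n) t ->
    [/\ prefix s t, (size s < size t)%N & nth 0 t (size s) = n].
  move=> /prefixP[r ->].
  rewrite -cats1 -catA size_cat /= nth_cat ltnn subnn /=.
  by split=> //; [exact: prefix_prefix|rewrite addnS ltnS leq_addr].
pose s k := sval (u k).1; pose t k := sval (u k).2.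
have sP k : prefix (s k) (s k.+1) /\ (size (s k) < size (s k.+1))%N.
  by have [n [n' [/rcons_chain[]]]] := uP k.
have tP k : prefix (t k) (t k.+1) /\ (size (t k) < size (t k.+1))%N.
  by have [n [n' [_ /rcons_chain[]]]] := uP k.
have s_lt k : (size (s k) < size (s k.+1))%N by case: (sP k).
have t_lt k : (size (t k) < size (t k.+1))%N by case: (tP k).
have [f fP] := chain_branch sP; have [g gP] := chain_branch tP.
have branch (h : nat -> nat) r : (forall k, T (r k)) ->
    (forall k, (size (r k) < size (r k.+1))%N) ->
    (forall k i, (i < size (r k))%N -> h i = nth 0 (r k) i) -> branches T h.
  move=> Tr r_lt hr n; apply: T_tree (Tr n).
  have nr : (n <= size (r n))%N := @ltn_homo_ge (fun k => size (r k)) n r_lt.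
  suff -> : mkseq h n = take n (r n) by exact: prefix_take.
  apply: (@eq_from_nth _ 0); rewrite size_mkseq ?size_take_min ?(minn_idPl _)//.
  move=> i iltn; rewrite nth_mkseq// nth_take// (hr n)//; exact: leq_trans nr.
have Sf : branches T f.
  by apply: (branch f s) => // k; case: (svalP (u k).1).
have Sg : branches T g.
  by apply: (branch g t) => // k; case: (svalP (u k).2).
have incr_leq h : branches T h -> {homo h : m n / (m <= n)%N}.
  move=> /S_incr h_incr m n; rewrite leq_eqVlt => /predU1P[->//|mn].
  by apply: ltnW; exact: h_incr.
have f_leq := incr_leq f Sf; have g_leq := incr_leq g Sg.
exists f, g; split=> //; apply/finite_set_natP.
exists (f (size (s 0))) => v [[i _ fi] [j _ gj]].
rewrite ltnNge; apply/negP => v_ge.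
have i_ge : (size (s 0) <= i)%N.
  rewrite leqNgt; apply/negP => i_lt.
  by have := S_incr _ Sf _ _ i_lt; rewrite fi ltnNge v_ge.
have [k [ki ik]] := @ltn_homo_locate (fun k => size (s k)) i s_lt i_ge.
(* The common value [v] is at least [n], hence above all of [t k]; so it occurs in [g] after [t k]
   and is at least [n'], which exceeds every entry of [s k.+1], among them [v]. *)
have [n [n' [/rcons_chain[_ sk_lt fn] /rcons_chain[_ tk_lt gn'] tn sn']]] := uP k.
have vs : v \in s k.+1 by rewrite -fi (fP k.+1)// mem_nth.
have nv : (n <= v)%N by rewrite -fi -fn -(fP k.+1)//; exact: f_leq.
have [jt|tj] := ltnP j (size (t k)).
  have /tn : v \in t k by rewrite -gj (gP k)// mem_nth.
  by rewrite ltnNge nv.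
have := sn' v vs; rewrite -gn' -(gP k.+1)// ltnNge -gj g_leq//.
Qed.

Lemma regular_filter_eventually_meets (E : set infset) :
  (forall x y, E x -> elements x `<=` elements y -> E y) ->
  (forall x y, E x -> E y -> infinite_set (elements x `&` elements y)) ->
  Baire_measurable E \/ K_sigma_regular E ->
  exists h, forall x, E x -> eventually_meets (elements x) h.
Proof.
move=> E_up E_ad [[U [U_open EU]]|[[K [K_sc EK]]|[S [S_sp SE]]]].
(* For empty [U] the set [E] is meager; otherwise it is comeager in a basic open subset of [U] and
   has two almost disjoint elements. *)
- have [U0|/set0P[x0 Ux0]] := eqVneq U set0.
    by apply: meager_eventually_meets => //; rewrite U0 setY0 in EU.
  have [n0 n0U] : exists n, forall y : infset,
      (forall i, (i < n)%N -> elements y i <-> elements x0 i) -> U y.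
    by apply/nbhs_infset; exact: open_nbhs_nbhs.
  have [F [F_nd EUF]] := EU.
  have [x [y [xyF xx0 yx0 xy]]] := comeager_almost_disjoint x0 n0 F_nd.
  have inE z : (forall k, ~ F k z) -> U z -> E z.
    move=> zF Uz; apply: contrapT => nEz; have [|k _ /zF//] := EUF z.
    by right.
  case: (E_ad x y) => //; apply: inE => [k|]; [|exact: n0U| |exact: n0U].
    by case: (xyF k).
  by case: (xyF k).
- have [h hP] := sigma_compact_eventually_meets K_sc.
  by exists h => x /EK/hP.
- have S_incr : S `<=` increasing_functions.
    by move=> f /SE[x _ <-]; exact: infset_incr.
  have [f [g [/SE[x Ex <-] /SE[y Ey <-] fg]]] := superperfect_almost_disjoint S_sp S_incr.
  by case: (E_ad x y).
Qed.

(** * Analytic sets *)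

Section Continuity.
Context {X : topologicalType}.

Lemma continuous_natP (u : X -> nat) :
  continuous u <-> forall x, \forall y \near x, u y = u x.
Proof.
split=> [u_cts x|h x A /= Aux].
  by have /= := u_cts x [set u x]; apply; exact: discrete_set1.
by apply: filterS (h x) => y; rewrite /= => ->; exact: nbhs_singleton.
Qed.

Lemma continuous_baireP (f : X -> baire) :
  continuous f <-> forall n, continuous (fun x => f x n : nat).
Proof.
split=> [f_cts n x|h x A /= /nbhs_baire[n nA]].
  apply: (@continuous_comp X baire nat f (fun g => g n)); first exact: f_cts.
  exact: (@proj_continuous nat (fun _ => nat) n).
suff : \forall y \near x, forall i, (i < n)%N -> f y i = f x i.
  by apply: filterS => y; exact: nA.
elim: n {nA} => [|n IH]; first by apply: filterS filterT.
have /continuous_natP/(_ x) fn := h n.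
by apply: filterS2 IH fn => y IHy fny i; rewrite ltnS leq_eqVlt => /predU1P[->|/IHy].
Qed.

Lemma continuous_eval (c : X -> baire) (u : X -> nat) :
  continuous c -> continuous u -> continuous (fun x => c x (u x) : nat).
Proof.
move=> /continuous_baireP c_cts /continuous_natP u_cts; apply/continuous_natP => x.
have /continuous_natP/(_ x) cx := c_cts (u x).
by apply: filterS2 cx (u_cts x) => y cy ->.
Qed.

Lemma closed_natP (u v : X -> nat) (Q : nat -> nat -> Prop) :
  continuous u -> continuous v -> closed [set x | Q (u x) (v x)].
Proof.
move=> /continuous_natP u_cts /continuous_natP v_cts; rewrite -openC openE => x nQ.
by apply: filterS2 (u_cts x) (v_cts x) => y; rewrite /= => -> ->.
Qed.

End Continuity.

Lemma continuous_infset_val n : continuous (fun x : infset => (set_val x : nat -> nat) n).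
Proof.
apply/continuous_natP => x; apply/nbhs_infset_val; exists n.+1 => y; exact.
Qed.

Lemma fst_continuous (X Y : topologicalType) : continuous (fst : X * Y -> X).
Proof. by move=> p; exact: cvg_fst. Qed.

Lemma snd_continuous (X Y : topologicalType) : continuous (snd : X * Y -> Y).
Proof. by move=> p; exact: cvg_snd. Qed.

Lemma pair_continuous (X Y Z : topologicalType) (f : X -> Y) (g : X -> Z) :
  continuous f -> continuous g -> continuous (fun x => (f x, g x)).
Proof. by move=> f_cts g_cts x; apply: cvg_pair; [exact: f_cts|exact: g_cts]. Qed.

Lemma comp_continuous (X Y Z : topologicalType) (f : X -> Y) (g : Y -> Z) :
  continuous f -> continuous g -> continuous (fun x => g (f x)).
Proof. by move=> f_cts g_cts x; apply: continuous_comp; [exact: f_cts|exact: g_cts]. Qed.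

Lemma preimage_closed (X Y : topologicalType) (f : X -> Y) (F : set Y) :
  continuous f -> closed F -> closed (f @^-1` F).
Proof. by move=> /continuous_closedP; apply. Qed.

Lemma reindex_continuous (e : nat -> nat) :
  continuous ((fun f n => f (e n)) : baire -> baire).
Proof.
by apply/continuous_baireP => n; exact: (@proj_continuous nat (fun _ => nat) (e n)).
Qed.

Section Sigma11Theory.
Context {X : topologicalType}.
Implicit Types A : set X.

Lemma closed_Sigma11 A : closed A -> Sigma11 A.
Proof.
move=> A_closed; exists (fst @^-1` A); split.
  exact: preimage_closed (@fst_continuous _ _) _.
by apply/seteqP; split=> x /= => [Ax|[]//]; exists (fun=> 0).
Qed.

Lemma bigcup_Sigma11 (A : nat -> set X) :
  (forall n, Sigma11 (A n)) -> Sigma11 (\bigcup_n A n).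
Proof.
move=> /choice[F /all_and2[F_closed AF]].
(* The first value of a witness names an index [n], and the shifted rest is a witness for [A n]. *)
pose shift (p : X * baire) : X * baire := (p.1, (fun n => p.2 n.+1) : baire).
have shift_cts : continuous shift.
  apply: pair_continuous (@fst_continuous _ _) _.
  exact: comp_continuous (@snd_continuous _ _) (@reindex_continuous S).
exists [set p | F (p.2 0) (shift p)]; split.
  have -> : [set p : X * baire | F (p.2 0) (shift p)] =
      \bigcap_n ([set p | p.2 0 <> n] `|` shift @^-1` F n).
    apply/seteqP; split=> [p Fp n _|p /(_ (p.2 0) I)[//|]//].
    by have [<-|] := pselect (p.2 0 = n); [right|left].
  apply: closed_bigI => n _; apply: closedU; last exact: preimage_closed.
  have c0 : continuous (fun p : X * baire => p.2 0 : nat).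
    exact: ((continuous_baireP snd).1 (@snd_continuous X baire) 0).
  exact: (@closed_natP _ _ _ (fun k _ => k <> n) c0 c0).
apply/seteqP; split=> x.
  move=> [n _]; rewrite AF => -[y Fy].
  by exists (fun k => if k is k'.+1 then y k' else n).
move=> [y /= Fy]; exists (y 0) => //; rewrite AF; by exists (fun n => y n.+1).
Qed.

Lemma bigcap_Sigma11 (A : nat -> set X) :
  (forall n, Sigma11 (A n)) -> Sigma11 (\bigcap_n A n).
Proof.
move=> /choice[F /all_and2[F_closed AF]].
(* One point of the Baire space holds witnesses for all [n], its [n]-th row being the one for
   [A n]. *)
pose row (n : nat) (p : X * baire) : X * baire :=
  (p.1, (fun k => p.2 (choice.pickle (n, k))) : baire).
have row_cts n : continuous (row n).
  apply: pair_continuous (@fst_continuous _ _) _.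
  exact: comp_continuous (@snd_continuous _ _)
    (@reindex_continuous (fun k => choice.pickle (n, k))).
exists (\bigcap_n (row n @^-1` F n)); split.
  by apply: closed_bigI => n _; exact: preimage_closed.
apply/seteqP; split=> x; last first.
  move=> [y Fy] n _; rewrite AF; exists (fun k => y (choice.pickle (n, k))).
  exact: Fy.
move=> Ax; have /choice[y yP] n : exists y, F n (x, y).
  by have := Ax n I; rewrite AF.
pose z : baire := fun m =>
  if (choice.unpickle m : option (nat * nat)) is Some nk then y nk.1 nk.2 else 0.
exists z => n _; suff -> : (row n @^-1` F n) (x, z) = F n (x, y n) by [].
by congr (F n (_, _)); apply/funext => k; rewrite /z /= choice.pickleK.
Qed.

Lemma setI_Sigma11 A B : Sigma11 A -> Sigma11 B -> Sigma11 (A `&` B).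
Proof.
move=> SA SB; rewrite -bigcap2E; apply: bigcap_Sigma11 => -[|[|n]] //=.
exact/closed_Sigma11/closedT.
Qed.

Lemma setU_Sigma11 A B : Sigma11 A -> Sigma11 B -> Sigma11 (A `|` B).
Proof.
move=> SA SB; rewrite -bigcup2E; apply: bigcup_Sigma11 => -[|[|n]] //=.
exact/closed_Sigma11/closed0.
Qed.

Lemma eventually_Sigma11 (A : nat -> set X) : (forall n, closed (A n)) ->
  Sigma11 [set x | exists m, forall n, (m <= n)%N -> A n x].
Proof.
move=> A_closed.
have -> : [set x | exists m, forall n, (m <= n)%N -> A n x] =
    \bigcup_m \bigcap_(n in [set n | (m <= n)%N]) A n.
  by apply/seteqP; split=> x [m] => [h|_ h]; exists m.
by apply: bigcup_Sigma11 => m; apply: closed_Sigma11; exact: closed_bigI.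
Qed.

Lemma exists_baire_Sigma11 (A : set (X * baire)) :
  Sigma11 A -> Sigma11 [set x | exists y, A (x, y)].
Proof.
move=> [F [F_closed ->]].
(* Two successive projections merge into one by interleaving the witnesses on even and odd
   positions. *)
pose split2 (p : X * baire) : X * baire * baire :=
  ((p.1, (fun n => p.2 n.*2) : baire), (fun n => p.2 n.*2.+1) : baire).
exists (split2 @^-1` F); split.
  apply: preimage_closed F_closed; apply: pair_continuous.
    apply: pair_continuous (@fst_continuous _ _) _.
    exact: comp_continuous (@snd_continuous _ _) (@reindex_continuous double).
  exact: comp_continuous (@snd_continuous _ _) (@reindex_continuous (fun n => n.*2.+1)).
apply/seteqP; split=> x [y /=].
  move=> [z Fyz]; exists (fun n => if odd n then z n./2 else y n./2).
  have -> // : split2 (x, fun n => if odd n then z n./2 else y n./2) = ((x, y), z).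
  congr (_, _, _); apply/funext => n /=; first by rewrite odd_double doubleK.
  by rewrite odd_double /= uphalf_double.
by move=> Fy; exists (fun n => y n.*2); exists (fun n => y n.*2.+1).
Qed.

End Sigma11Theory.

Lemma preimage_Sigma11 (X Y : topologicalType) (f : X -> Y) (A : set Y) :
  continuous f -> Sigma11 A -> Sigma11 (f @^-1` A).
Proof.
move=> f_cts [F [F_closed ->]].
exists ((fun p : X * baire => (f p.1, p.2)) @^-1` F); split=> //.
apply: preimage_closed F_closed; apply: pair_continuous (@snd_continuous _ _).
exact: comp_continuous (@fst_continuous _ _) f_cts.
Qed.

(* Since [of_gaps] is a continuous surjection, projecting along [infset] amounts
   to projecting along the Baire space. *)
Lemma gaps_incr (f : nat -> nat) :
  increasing_functions (fun n => \sum_(i < n.+1) f i + n).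
Proof.
by apply: homo_ltn => [y x z|n]; [exact: ltn_trans|rewrite [in ltnRHS]big_ord_recr /=; lia].
Qed.

Definition of_gaps (f : baire) : infset := infset_of (@gaps_incr f).

Lemma of_gaps_continuous : continuous of_gaps.
Proof.
move=> f A /= /nbhs_infset_val[n nA]; apply/nbhs_baire; exists n => g gf.
apply: nA => i ilt /=; congr (_ + _); apply: eq_bigr => -[j /= jlt] _.
by apply: gf; exact: leq_trans ilt.
Qed.

Lemma of_gaps_surj (x : infset) : exists f, of_gaps f = x.
Proof.
pose v := (set_val x : nat -> nat).
(* The extra 1 subtracted from each gap is restored by the summand [n] in [of_gaps]. *)
exists (fun n => if n is m.+1 then v m.+1 - (v m).+1 else v 0).
apply: val_inj; apply/funext => n /=; rewrite -[RHS]/(v n).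
elim: n => [|n IH]; first by rewrite big_ord_recr big_ord0 /=; lia.
have := infset_incr x (ltnSn n); rewrite -/v big_ord_recr /=; lia.
Qed.

Lemma exists_infset_Sigma11 (X : topologicalType) (A : set (X * infset)) :
  Sigma11 A -> Sigma11 [set x | exists y, A (x, y)].
Proof.
move=> SA.
have -> : [set x | exists y, A (x, y)] =
    [set x | exists f : baire, A (x, of_gaps f)].
  apply/seteqP; split=> x [y Ay]; last by exists (of_gaps y).
  by have [f fy] := of_gaps_surj y; exists f; rewrite fy.
apply: (@exists_baire_Sigma11 _ [set p : X * baire | A (p.1, of_gaps p.2)]).
apply: (@preimage_Sigma11 _ _ (fun p : X * baire => (p.1, of_gaps p.2))) SA.
apply: pair_continuous (@fst_continuous _ _) _.
exact: comp_continuous (@snd_continuous _ _) of_gaps_continuous.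
Qed.

Lemma open_Sigma11 (U : set infset) : open U -> Sigma11 U.
Proof.
move=> U_open.
(* Membership in [V n] depends only on the first [n] values, so [V n] is closed and [U] is a
   countable union of closed sets. *)
pose V n := [set x : infset | forall y : infset, (forall i, (i < n)%N ->
  (set_val y : nat -> nat) i = (set_val x : nat -> nat) i) -> U y].
have -> : U = \bigcup_n V n.
  apply/seteqP; split=> x; last by move=> [n _]; apply.
  move=> Ux; have /nbhs_infset_val[n nU] := open_nbhs_nbhs (conj U_open Ux).
  by exists n.
apply: bigcup_Sigma11 => n; apply: closed_Sigma11.
rewrite -openC openE => x nVx; apply/nbhs_infset_val; exists n => y yx Vy.
by apply: nVx => z zx; apply: Vy => i ilt; rewrite zx// yx.
Qed.

(** The sets that are analytic together with their complements form a sigma-algebra containing the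
    open sets. *)
Lemma Borel_Sigma11 (B : set infset) : Borel B -> Sigma11 B.
Proof.
move=> B_borel; suff [] : Sigma11 B /\ Sigma11 (~` B) by [].
move: B B_borel; apply: smallest_sub; last first.
  move=> U U_open; split; first exact: open_Sigma11.
  by apply: closed_Sigma11; rewrite closedC.
split.
- by rewrite setC0; split; apply: closed_Sigma11; [exact: closed0|exact: closedT].
- by move=> A [SA SAc]; rewrite setTD setCK.
- move=> A /all_and2[SA SAc]; split; first exact: bigcup_Sigma11.
  by rewrite setC_bigcup; exact: bigcap_Sigma11.
Qed.

(** * Refining a countable family *)

(** Allowing arbitrary [Z], finite ones included, lets every point of the Baire space code a
    legitimate countable family through its rows. *)
Definition weakly_refines (y : infset) (Z : set nat) :=
  finite_set (elements y `\` Z) \/ finite_set (elements y `&` Z).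

Definition code_row (c : baire) (n : nat) : set nat := [set k | c (choice.pickle (n, k)) = 0].

(** This is the set [E] of the overview; [c] codes a countable family witnessing that the trace of
    [B] is not omega-refining. *)
Definition unrefined_traces (B : set infset) : set infset :=
  [set x | exists c : baire, forall y, B y -> finite_set (elements y `&` elements x) ->
     exists n, ~ weakly_refines y (code_row c n)].

Lemma finite_elements_setI (y : infset) (Z : set nat) :
  finite_set (elements y `&` Z) <->
  exists m, forall n, (m <= n)%N -> ~ Z ((set_val y : nat -> nat) n).
Proof.
rewrite finite_set_natP; split=> -[m h].
  exists m => n mn Zn; have := h _ (conj (ex_intro2 _ _ n I erefl) Zn).
  by rewrite ltnNge (leq_trans mn (infset_ge y n)).
exists ((set_val y : nat -> nat) m) => i [[n _ <-] Zi].
apply: infset_incr; rewrite ltnNge; apply/negP => /h; exact.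
Qed.

(** The complement of the matrix asserts that some [y] in [B], almost disjoint from [x], weakly
    refines all rows of [c]. This is a projection along [infset] of an analytic set. *)
Lemma unrefined_traces_Sigma12 (B : set infset) :
  Borel B -> Sigma12 (unrefined_traces B).
Proof.
move=> /Borel_Sigma11 SB.
exists [set p : infset * baire | forall y, B y ->
  finite_set (elements y `&` elements p.1) ->
  exists n, ~ weakly_refines y (code_row p.2 n)]; split=> //.
pose xcy_x (p : infset * baire * infset) := p.1.1.
pose xcy_c (p : infset * baire * infset) := p.1.2.
have x_cts : continuous xcy_x := comp_continuous (@fst_continuous _ _) (@fst_continuous _ _).
have c_cts : continuous xcy_c := comp_continuous (@fst_continuous _ _) (@snd_continuous _ _).
have y_cts k : continuous (fun p : infset * baire * infset => (set_val p.2 : nat -> nat) k).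
  exact: comp_continuous (@snd_continuous _ _) (@continuous_infset_val k).
pose A : set (infset * baire * infset) := [set p | B p.2] `&`
  ([set p | finite_set (elements p.2 `&` elements (xcy_x p))] `&`
   \bigcap_n ([set p | finite_set (elements p.2 `&` ~` code_row (xcy_c p) n)] `|`
              [set p | finite_set (elements p.2 `&` code_row (xcy_c p) n)])).
rewrite /Pi11.
have -> : ~` [set p : infset * baire | forall y, B y ->
    finite_set (elements y `&` elements p.1) ->
    exists n, ~ weakly_refines y (code_row p.2 n)] = [set p | exists y, A (p, y)].
  apply/seteqP; split=> p.
    move=> np; apply: contrapT => h; apply: np => y By yp.
    apply: contrapT => nn; apply: h; exists y; split=> //; split=> // n _.
    by apply: contrapT => nr; apply: nn; exists n; rewrite /weakly_refines setDE.
  move=> [y [/= By [yp ry]]] /(_ y By yp)[n]; apply.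
  by rewrite /weakly_refines setDE; exact: ry.
apply: exists_infset_Sigma11; apply: setI_Sigma11.
  exact: preimage_Sigma11 (@snd_continuous _ _) SB.
(* Finiteness of the intersection means that the enumeration of the third component eventually
   avoids [Z], a countable union of closed conditions. *)
have fin_Sigma11 (Z : infset * baire * infset -> set nat) :
    (forall k, closed [set p | ~ Z p ((set_val p.2 : nat -> nat) k)]) ->
    Sigma11 [set p | finite_set (elements p.2 `&` Z p)].
  move=> /eventually_Sigma11; congr Sigma11; apply/seteqP.
  by split=> p /=; rewrite finite_elements_setI.
apply: setI_Sigma11.
  apply: fin_Sigma11 => k.
  have -> : [set p : infset * baire * infset |
      ~ elements (xcy_x p) ((set_val p.2 : nat -> nat) k)] =
      \bigcap_j [set p | (set_val (xcy_x p) : nat -> nat) j <> (set_val p.2 : nat -> nat) k].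
    apply/seteqP; split=> p /= h; first by move=> j _ /= e; apply: h; exists j.
    by move=> [j _]; exact: (h j).
  apply: closed_bigI => j _; apply: (@closed_natP _ _ _ (fun a b => a <> b)) (y_cts k).
  exact: comp_continuous x_cts (@continuous_infset_val j).
have cell_cts (n k : nat) : continuous (fun p : infset * baire * infset =>
    xcy_c p (choice.pickle (n, (set_val p.2 : nat -> nat) k)) : nat).
  apply: (continuous_eval c_cts); apply/continuous_natP => p.
  by have /continuous_natP/(_ p) := y_cts k; apply: filterS => q /= ->.
apply: bigcap_Sigma11 => n; apply: setU_Sigma11; apply: fin_Sigma11 => k.
  exact: (@closed_natP _ _ _ (fun a _ => ~ ~ (a = 0))) (cell_cts n k) (cell_cts n k).
exact: (@closed_natP _ _ _ (fun a _ => ~ (a = 0))) (cell_cts n k) (cell_cts n k).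
Qed.

Lemma refines_weakly (y x : infset) : refines y x <-> weakly_refines y (elements x).
Proof. by rewrite /refines /weakly_refines [_ `\` ~` _]setDE setCK. Qed.

Lemma omega_refining_sets (B : set infset) (c : nat -> set nat) :
  omega_refining B -> exists2 y, B y & forall n, weakly_refines y (c n).
Proof.
(* Finite sets are weakly refined by everything, so an arbitrary infinite set may stand in for
   them. *)
move=> B_ref; have /choice[e eP] n : exists x : infset, infinite_set (c n) -> elements x = c n.
  have [cn|cn] := pselect (finite_set (c n)); last by have [x] := infset_enum cn; exists x.
  by have [x] := infset_enum infinite_nat; exists x.
have [|y By ye] := B_ref (range e).
  exact: sub_countable (card_image_le _ _) _.
exists y => // n; have [cn|cn] := pselect (finite_set (c n)).
  by right; apply: sub_finite_set cn => i [].
rewrite -(eP n cn); apply/refines_weakly/ye; by exists n.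
Qed.

Lemma omega_refining_setI (B : set infset) (x : infset) :
  ~ unrefined_traces B x ->
  omega_refining (B `&` [set y | finite_set (elements y `&` elements x)]).
Proof.
move=> nBx C /countable_injP[f f_inj].
(* Row [f z] codes [z]; the default value 1 leaves all other rows empty. *)
pose c : baire := fun m => if (choice.unpickle m : option (nat * nat)) is Some nk then
  if `[< exists z, [/\ C z, f z = nk.1 & elements z nk.2] >] then 0 else 1 else 1.
have cE z : C z -> code_row c (f z) = elements z.
  move=> Cz; apply/seteqP; split=> k; rewrite /code_row /c /= choice.pickleK /=.
    case: asboolP => // -[z' [Cz' /f_inj e z'k]] _.
    by rewrite -e ?inE.
  by move=> zk; case: asboolP => // -[]; exists z.
have [y [By yx yc]] : exists y, [/\ B y, finite_set (elements y `&` elements x) &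
    forall n, weakly_refines y (code_row c n)].
  apply: contrapT => h; apply: nBx; exists c => y By yx; apply: contrapT => nn.
  by apply: h; exists y; split=> // n; apply: contrapT => yn; apply: nn; exists n.
by exists y => // z Cz; apply/refines_weakly; rewrite -cE.
Qed.

(** Some [z] in [B] weakly refines [x], [y] and all rows of both witnesses at once. It cannot be
    almost disjoint from [x] or from [y], so it is almost contained in both, hence in their
    intersection. *)
Lemma unrefined_traces_setI (B : set infset) (x y : infset) : omega_refining B ->
  unrefined_traces B x -> unrefined_traces B y ->
  infinite_set (elements x `&` elements y).
Proof.
move=> B_ref [c cP] [d dP] xy_fin.
pose rows n := match n with
  | 0 => elements x
  | 1 => elements y
  | k.+2 => if odd k then code_row d k./2 else code_row c k./2
  end.
have [z Bz zr] := omega_refining_sets rows B_ref.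
have zx : finite_set (elements z `\` elements x).
  case: (zr 0) => // /(cP _ Bz)[n]; case.
  by have := zr n.*2.+2; rewrite /= odd_double doubleK.
have zy : finite_set (elements z `\` elements y).
  case: (zr 1) => // /(dP _ Bz)[n]; case.
  by have := zr n.*2.+3; rewrite /= odd_double /= uphalf_double.
apply: (@elements_infinite z).
apply: (@sub_finite_set _ _ ((elements x `&` elements y) `|`
  ((elements z `\` elements x) `|` (elements z `\` elements y)))).
  move=> i zi; have [xi|] := pselect (elements x i); last by right; left.
  by have [yi|] := pselect (elements y i); [left|right; right].
by rewrite !finite_setU.
Qed.

Lemma unrefined_traces_up (B : set infset) (x y : infset) :
  unrefined_traces B x -> elements x `<=` elements y -> unrefined_traces B y.
Proof.
move=> [c cP] xy; exists c => z Bz zy; apply: cP => //.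
by apply: sub_finite_set zy => i [zi /xy].
Qed.

(** * Conditions from interval partitions and reals *)

Definition block_start (g : nat -> nat) :=
  fix b n := if n is k.+1 then maxn (b k).+1 (g (b k)) else 0.

Lemma block_start_lt g k : (block_start g k < block_start g k.+1)%N.
Proof. exact: leq_maxl. Qed.

(** These sets form the usual almost disjoint family of branches through the binary tree, with nodes
    coded by numbers. *)
Definition initial_codes (r : set nat) : set nat :=
  range (fun n => choice.pickle (mkseq (fun i => `[< r i >]) n)).

Definition coded_blocks (g : nat -> nat) (r : set nat) : set nat :=
  [set i | exists k, [/\ initial_codes r k,
     (block_start g k <= i)%N & (i < block_start g k.+1)%N]].

Definition block_condition (g : nat -> nat) (r : set nat) : set infset :=
  [set y | finite_set (elements y `\` coded_blocks g r)].

Lemma initial_codes_infinite r : infinite_set (initial_codes r).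
Proof.
have f_inj : injective (fun n => choice.pickle (mkseq (fun i => `[< r i >]) n)).
  by move=> m n /(pcan_inj choice.pickleK)/(congr1 size); rewrite !size_mkseq.
move=> r_fin; apply: infinite_nat.
suff e : (range (fun n => choice.pickle (mkseq (fun i => `[< r i >]) n)) #= [set: nat])%card.
  by rewrite -(eq_finite_set e).
by apply: inj_card_eq => m n _ _; exact: f_inj.
Qed.

Lemma initial_codes_setI r r' : r <> r' ->
  finite_set (initial_codes r `&` initial_codes r').
Proof.
move=> rr'; have [i ri] : exists i, `[< r i >] <> `[< r' i >].
  apply: contrapT => h; apply: rr'; apply/seteqP; split=> i ri; apply: contrapT => nri.
    by apply: h; exists i; rewrite asboolT // asboolF.
  by apply: h; exists i; rewrite asboolF // asboolT.
apply: (@sub_finite_set _ _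
    ((fun n => choice.pickle (mkseq (fun i => `[< r i >]) n)) @` `I_i.+1)).
  move=> _ [[n _ <-] [m _ /(pcan_inj choice.pickleK) e]]; exists n => //=.
  have mn : m = n by have := congr1 size e; rewrite !size_mkseq.
  rewrite ltnS leqNgt; apply/negP => ilt; apply: ri.
  have := congr1 (fun s => nth false s i) e; rewrite mn !nth_mkseq//.
exact/finite_image/finite_II.
Qed.

Lemma coded_blocks_infinite g r : infinite_set (coded_blocks g r).
Proof.
apply/infinite_set_natP => n.
have [k rk nk] := (infinite_set_natP _).1 (@initial_codes_infinite r) n.
exists (block_start g k); first by exists k; split=> //; exact: block_start_lt.
by apply: leq_trans nk _; apply: ltn_homo_ge; exact: block_start_lt.
Qed.

(** The blocks being disjoint, a common point lies in a block whose index codes an initial segment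
    of both reals. *)
Lemma coded_blocks_setI g r r' : r <> r' ->
  finite_set (coded_blocks g r `&` coded_blocks g r').
Proof.
move=> /initial_codes_setI/finite_set_natP[n codes_lt].
apply/finite_set_natP; exists (block_start g n) => i.
case=> -[k [rk ki ik]] [k' [rk' k'i ik']].
have b_leq := ltn_homo_leq (@block_start_lt g).
suff kk' : k = k'.
  by apply: leq_trans ik _; apply: b_leq; apply: codes_lt; rewrite -kk' in rk'.
apply/eqP; rewrite eqn_leq; apply/andP; split; rewrite leqNgt; apply/negP => /b_leq.
  by move=> /(leq_trans ik'); rewrite ltnNge ki.
by move=> /(leq_trans ik); rewrite ltnNge k'i.
Qed.

(** The blocks coded by the complement of [r] form an infinite set almost disjoint from those coded
    by [r]. *)
Lemma coded_blocksC_infinite g r : infinite_set (~` coded_blocks g r).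
Proof.
have rr' : r <> ~` r.
  by move=> /(congr1 (fun s : set nat => s 0)); rewrite /setC /= => e; have [|n] := pselect (r 0);
    [move=> r0; have : ~ r 0 by rewrite -e|apply: (n); rewrite e].
move=> Wc; apply: (@coded_blocks_infinite g (~` r)).
apply: (@sub_finite_set _ _ (~` coded_blocks g r `|`
  (coded_blocks g r `&` coded_blocks g (~` r)))).
  by move=> i Wi; have [?|?] := pselect (coded_blocks g r i); [right|left].
by rewrite finite_setU; split=> //; exact: coded_blocks_setI.
Qed.

Lemma block_condition_inj g r r' (y : infset) :
  block_condition g r y -> block_condition g r' y -> r = r'.
Proof.
move=> yr yr'; apply: contrapT => /(@coded_blocks_setI g) rr'.
apply: (@elements_infinite y).
apply: (@sub_finite_set _ _ ((coded_blocks g r `&` coded_blocks g r') `|`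
  ((elements y `\` coded_blocks g r) `|` (elements y `\` coded_blocks g r')))).
  move=> i yi; have [ri|] := pselect (coded_blocks g r i); last by right; left.
  by have [r'i|] := pselect (coded_blocks g r' i); [left|right; right].
by rewrite !finite_setU.
Qed.

Lemma Borel_setI (X : topologicalType) (A B : set X) :
  Borel A -> Borel B -> Borel (A `&` B).
Proof.
move=> A_borel B_borel; rewrite -[A `&` B]setCK setCI -bigcup2E -setTD.
apply: sigma_algebraCD; apply: sigma_algebra_bigcup => -[|[|n]] /=.
- by rewrite -setTD; exact: sigma_algebraCD.
- by rewrite -setTD; exact: sigma_algebraCD.
- exact: sigma_algebra0.
Qed.

Lemma closed_Borel (X : topologicalType) (A : set X) : closed A -> Borel A.
Proof.
move=> A_closed; rewrite -[A]setCK -setTD; apply: sigma_algebraCD.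
by apply: sub_sigma_algebra; rewrite /= openC.
Qed.

Lemma block_condition_Borel g r : Borel (block_condition g r).
Proof.
(* Almost containment says that the enumeration eventually stays in the blocks, an F-sigma
   condition. *)
have -> : block_condition g r = \bigcup_m \bigcap_(n in [set n | (m <= n)%N])
    [set y : infset | ~ ~ coded_blocks g r ((set_val y : nat -> nat) n)].
  apply/seteqP; split=> y; rewrite /block_condition /= setDE finite_elements_setI.
    by move=> [m h]; exists m.
  by move=> [m _ h]; exists m.
apply: sigma_algebra_bigcup => m; apply: closed_Borel; apply: closed_bigI => n _.
exact: (@closed_natP _ _ _ (fun k _ => ~ ~ coded_blocks g r k)
  (@continuous_infset_val n) (@continuous_infset_val n)).
Qed.

Lemma omega_refining_block_condition (B : set infset) :
  (forall A : set infset, Sigma12 A -> Baire_measurable A \/ K_sigma_regular A) ->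
  Borel B -> omega_refining B ->
  exists h : nat -> nat, forall g : nat -> nat, (\forall n \near \oo, (h n <= g n)%N) ->
    forall r, omega_refining (B `&` block_condition g r).
Proof.
move=> regular B_borel B_ref.
have [h hP] := regular_filter_eventually_meets (@unrefined_traces_up B)
  (fun x y => @unrefined_traces_setI B x y B_ref)
  (regular _ (unrefined_traces_Sigma12 B_borel)).
exists h => g [m1 _ hg] r.
have [x xW] := infset_enum (@coded_blocksC_infinite g r).
have -> : block_condition g r = [set y | finite_set (elements y `&` elements x)].
  by rewrite xW; apply/seteqP; split=> y; rewrite /block_condition /= setDE.
apply: omega_refining_setI => /hP[m2 xh].
(* The threshold [m1] comes from domination and [m2] from eventual meeting; both apply at
   [block_start g k], which is at least [k]. The point of [x] found below [h (block_start g k)] then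
   lies in the [k]-th block, although [x] enumerates the complement of the coded blocks. *)
have [k rk mk] := (infinite_set_natP _).1 (@initial_codes_infinite r) (maxn m1 m2).
have kb : (k <= block_start g k)%N by apply: ltn_homo_ge; exact: block_start_lt.
have [|i [xi ki ik]] := xh (block_start g k).
  exact: leq_trans (leq_trans (leq_maxr _ _) mk) kb.
suff : coded_blocks g r i by move: xi; rewrite xW.
exists k; split=> //; apply: leq_trans ik _; apply: leq_trans (leq_maxr _ _).
by apply: hg; exact: leq_trans (leq_trans (leq_maxl _ _) mk) kb.
Qed.

Theorem theorem7p16 :
  (forall A : set infset, Sigma12 A -> Baire_measurable A \/ K_sigma_regular A) ->
  forall d : vset, is_dominating_number d ->
    forced refining_le
      (exists_surjection (check refining_forcing d)
                         (check refining_forcing vreals)).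
Proof.
move=> regular [A a] [[_ [D [D_dom [F [FD F_inj _]]]]] _].
(* [F] indexes the dominating family by elements of the cardinal, so [M i r q] says that [q] lies
   below the block condition of [r] for the function with index [a i]. *)
pose M (i : A) (r : set nat) (q : refining_forcing) := exists g,
  [/\ D g, veq (F g) (a i) & proj1_sig q `<=` block_condition g r].
have le_trans p q r : refining_le p q -> refining_le q r -> refining_le p r.
  exact: subset_trans.
have le_refl p : refining_le p p by [].
apply: (@forces_surjection_of_partial _ _ le_refl le_trans
  _ _ _ _ set0 M).
- move=> i r p q qp [g [Dg gi pg]]; exists g; split=> //; exact: subset_trans pg.
- move=> i i' r r' q ii' [g [Dg gi qg]] [g' [Dg' gi' qg']].
  have gg' : g = g'.
    by apply: F_inj => //; apply: veq_trans gi (veq_trans ii' (veq_sym gi')).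
  case: q qg qg' => B [B_borel B_ref] /= Bg Bg'.
  (* Refining the empty family amounts to [B] being nonempty, and one [y] satisfying both block
     conditions forces the reals to agree. *)
  have [y By _] := B_ref set0 (countable0 _).
  by apply: (@block_condition_inj g r r' y); [exact: Bg|rewrite gg'; exact: Bg'].
- move=> r [B [B_borel B_ref]].
  have [h hP] := omega_refining_block_condition regular B_borel B_ref.
  (* For a [g] in [D] dominating [h], the block conditions for all reals are compatible with [B], so
     any given [r] can be made the value at the index of [g]. *)
  have [g Dg hg] := D_dom h; have [i gi] := FD g Dg.
  exists (exist _ (B `&` block_condition g r)
    (conj (Borel_setI B_borel (@block_condition_Borel g r)) (hP g hg r))).
    by move=> y [].
  by exists i, g; split=> // y [].
Qed.
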